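(* Let $D$ be a weakly locally finite division ring, let $n\ge1$, and let $G$ be an infinite almost subnormal subgroup of $\mathrm{GL}_n(D)$. If $G$ is finitely generated, then $G$ is central, i.e. contained in the center of $\mathrm{GL}_n(D)$.
   Context: A division ring $D$ is weakly locally finite if every finite subset of $D$ generates a division subring that is finite-dimensional over its own center. A subgroup $H$ of a group $K$ is almost subnormal in $K$ if there is a chain of subgroups $H=H_r\le H_{r-1}\le\cdots\le H_1=K$ such that for each $1<i\le r$, either $H_i$ is normal in $H_{i-1}$ or $H_i$ has finite index in $H_{i-1}$. *)

(* Defs.v *)
From HB Require Import structures.
From mathcomp Require Import all_boot all_order all_algebra.
Set Implicit Arguments. Unset Strict Implicit. Unset Printing Implicit Defensive.
Import GRing.Theory.
Local Open Scope ring_scope.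

Definition is_division_ring (D : unitRingType) : Prop :=
  forall x : D, x != 0 -> x \is a GRing.unit.

Definition division_subring (D : unitRingType) (K : D -> Prop) : Prop :=
  [/\ K 1,
      (forall x y, K x -> K y -> K (x - y)),
      (forall x y, K x -> K y -> K (x * y)) &
      (forall x, K x -> x != 0 -> K (x^-1))].

Definition gen_division_subring (D : unitRingType) (s : seq D) : D -> Prop :=
  fun x => forall K : D -> Prop, division_subring K -> (forall y, y \in s -> K y) -> K x.

Definition subring_center (D : unitRingType) (K : D -> Prop) : D -> Prop :=
  fun z => K z /\ forall y, K y -> z * y = y * z.

Definition findim_over_center (D : unitRingType) (K : D -> Prop) : Prop :=
  exists b : seq D, (forall y, y \in b -> K y) /\
    forall x, K x -> exists c : seq D, size c = size b /\
      (forall z, z \in c -> subring_center K z) /\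
      x = \sum_(i < size b) c`_i * b`_i.

Definition weakly_locally_finite (D : unitRingType) : Prop :=
  forall s : seq D, findim_over_center (gen_division_subring s).

Definition GLn (D : unitRingType) (n : nat) (A : 'M[D]_n) : Prop :=
  exists B : 'M[D]_n, A *m B = 1%:M /\ B *m A = 1%:M.

Definition is_subgroup (D : unitRingType) (n : nat) (H : 'M[D]_n -> Prop) : Prop :=
  [/\ (forall A, H A -> GLn A),
      H 1%:M,
      (forall A B, H A -> H B -> H (A *m B)) &
      (forall A B, H A -> A *m B = 1%:M -> B *m A = 1%:M -> H B)].

Definition subset_pred (T : Type) (H K : T -> Prop) : Prop := forall x, H x -> K x.

Definition normal_in (D : unitRingType) (n : nat) (H K : 'M[D]_n -> Prop) : Prop :=
  forall x h y, K x -> H h -> x *m y = 1%:M -> y *m x = 1%:M -> H (x *m h *m y).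

Definition finite_index_in (D : unitRingType) (n : nat) (H K : 'M[D]_n -> Prop) : Prop :=
  exists gs : seq 'M[D]_n, (forall g, g \in gs -> K g) /\
    forall x, K x -> exists2 g, g \in gs & exists2 h, H h & x = g *m h.

Definition almost_subnormal (D : unitRingType) (n : nat) (H K : 'M[D]_n -> Prop) : Prop :=
  exists (r : nat) (Hs : nat -> 'M[D]_n -> Prop),
    [/\ (forall x, Hs 0%N x <-> K x),
        (forall x, Hs r x <-> H x),
        (forall i, (i <= r)%N -> is_subgroup (Hs i)) &
        (forall i, (i < r)%N -> subset_pred (Hs i.+1) (Hs i) /\
             (normal_in (Hs i.+1) (Hs i) \/ finite_index_in (Hs i.+1) (Hs i)))].

Definition infinite_pred (T : eqType) (H : T -> Prop) : Prop :=
  ~ exists s : seq T, forall x, H x -> x \in s.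

Definition fin_generated (D : unitRingType) (n : nat) (G : 'M[D]_n -> Prop) : Prop :=
  exists s : seq 'M[D]_n, (forall g, g \in s -> G g) /\
    forall x, G x -> forall H, is_subgroup H -> (forall g, g \in s -> H g) -> H x.

Definition central_in_GL (D : unitRingType) (n : nat) (G : 'M[D]_n -> Prop) : Prop :=
  forall g, G g -> forall A, GLn A -> g *m A = A *m g.

(* Main.v *)
Require Import Defs.
From HB Require Import structures.
From mathcomp Require Import all_boot all_order all_algebra all_field.
From mathcomp Require Import boolp.
Set Implicit Arguments. Unset Strict Implicit. Unset Printing Implicit Defensive.
Import GRing.Theory.
Local Open Scope ring_scope.

(* Suppose that [g] in [G] does not commute with some matrix [M]. The entries of
   [M], of [g] and of the generators of [G] (and of the inverses) generate a
   division ring [D1] that is finite-dimensional over its center [F], so that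
   [A = M_n(D1)] is a central simple [F]-algebra containing [G]. Embed [A] in a
   matrix algebra over [F] by its regular representation, and choose a
   homomorphism to a finite field [k], defined on a finitely generated subring
   of [F] that contains the entries of the elements of [G] and is large enough
   for the reduction [B] of [A] to remain simple, with [g] not central. Since
   [B] is finite, Wedderburn's little theorem provides an idempotent [e] with
   [e B e = k e], and then [n] in [e B (1 - e)] such that [n g n] and
   [n g^-1 n] are nonzero multiples of [n], while [n^2 = 0].
   Let [a] and [u] be units of [A] lifting [1 - e] and [1 + n]. After extending
   the homomorphism as in Chevalley's theorem, some multiple of [a^-1] reduces
   to a nonzero multiple of [e]; hence [y = a^-1 u a] and [y^-1] both have
   multiples that reduce to [n] up to a nonzero factor, and [x = y g^-1] has the
   property that multiples of [x] and [x^-1] reduce to [n g^-1] and [g n], up to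
   nonzero factors. This property passes from [x] to the commutator
   [x g x^-1 g^-1] and to the powers of [x]. Along the almost subnormal chain,
   taking the commutator with [g] at a normal step and a suitable power at a
   step of finite index, it is inherited by some [x] in [G]. But then [x] and
   [x^-1] can be reduced without taking multiples, which forces [n = 0]. *)

(** * Reduction of a field to finite fields *)

Lemma finField_root_ext (k : finFieldType) (p : {poly k}) : (1 < size p)%N ->
  exists (k' : finFieldType) (i : {rmorphism k -> k'}) (a : k'),
    root (map_poly i p) a.
Proof.
move=> p_gt1; have nz_p: p != 0 by rewrite -size_poly_gt0 ltnW.
have [L [zs /= Dp _]] := FinSplittingFieldFor nz_p.
have: (1 < size (map_poly (in_alg L) p))%N by rewrite size_map_poly.
rewrite (eqp_size Dp) size_prod_XsubC; case: zs Dp => // z zs Dp _.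
exists (FinFieldExtType L), (in_alg L : {rmorphism k -> L}), z.
by rewrite (eqp_root Dp) root_prod_XsubC mem_head.
Qed.

(** Being a power of [a], the inverse lies in every subring that contains [a]. Divisions in a
    residue field can thus be carried out on lifts, in a ring without inverses. *)
Lemma finField_inv_exp (k : finFieldType) (a : k) :
  a != 0 -> exists N, a ^+ N * a = 1.
Proof.
move=> nz_a; exists #|k|.-2; rewrite -exprSr.
have card_gt1 := card_finNzRing_gt1 k.
apply: (mulIf nz_a); rewrite mul1r -exprSr -[RHS]expf_card; congr (_ ^+ _).
by case: #|_| card_gt1 => [|[]].
Qed.

Lemma ex_minimal (T : Type) (P : T -> Prop) (f : T -> nat) (x : T) : P x ->
  exists2 y, P y & forall z, P z -> (f y <= f z)%N.
Proof.
have [n] := ubnP (f x); elim: n x => // n IHn x; rewrite ltnS => le_fx Px.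
have [min_x|/existsNP[y /not_implyP[Py /negP]]] :=
  pselect (forall z, P z -> (f x <= f z)%N); first by exists x.
by rewrite -ltnNge => lt_yx; apply: (IHn y) => //; apply: leq_trans le_fx.
Qed.

Section Places.
Variable F : fieldType.
Implicit Types (R : comNzRingType).

(** The condition on the kernel makes [h] a homomorphism on the image of [e]. This is a form of the
    Nullstellensatz for that subring of [F]; allowing every [f] is what lets it pass from [R] to
    [{poly R}]. *)
Definition separating R (e : {rmorphism R -> F}) :=
  forall f, e f != 0 -> exists (k : finFieldType) (h : {rmorphism R -> k}),
    (forall r, e r = 0 -> h r = 0) /\ h f != 0.

Lemma separating_int (e : {rmorphism int -> F}) : separating e.
Proof.
have eE m : e m = m%:~R by rewrite -[m in LHS]intz rmorph_int.
move=> f nz_f; have [[p pcharF]|noF] := pselect (exists p, p \in [pchar F]).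
  have p_pr := pcharf_prime pcharF.
  have h0E (m : int) : ((m%:~R : 'F_p) == 0) = (m%:~R == 0 :> F).
    case: m => n; rewrite ?NegzE ?rmorphN /= ?oppr_eq0 -!pmulrn.
      by rewrite -(dvdn_pcharf (pchar_Fp p_pr)) -(dvdn_pcharf pcharF).
    by rewrite -(dvdn_pcharf (pchar_Fp p_pr)) -(dvdn_pcharf pcharF).
  exists 'F_p, (intr : {rmorphism int -> 'F_p}); split=> [r /eqP|].
    by rewrite eE -h0E => /eqP.
  by rewrite h0E -eE.
have e0 m : e m = 0 -> m = 0.
  have nat0 n : n%:R = 0 :> F -> n = 0%N.
    move=> n0; apply: contrapT => /eqP; rewrite -lt0n => n_gt0; apply: noF.
    exact: natf0_pchar n_gt0 (introT eqP n0).
  rewrite eE; case: m => n; first by rewrite -pmulrn => /nat0->.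
  by rewrite NegzE rmorphN /= -pmulrn => /eqP; rewrite oppr_eq0 => /eqP/nat0.
have nz_f0 : (0 < `|f|)%N.
  by rewrite lt0n absz_eq0; apply: contraNneq nz_f => ->; rewrite rmorph0.
have [p p_gt p_pr] := prime_above `|f|.
exists 'F_p, (intr : {rmorphism int -> 'F_p}); split=> [r /e0->|].
  by rewrite rmorph0.
have h0E (m : int) : ((m%:~R : 'F_p) == 0) = (p %| `|m|)%N.
  rewrite [RHS](dvdn_pcharf (pchar_Fp p_pr)).
  by case: m => n; rewrite ?NegzE ?rmorphN /= ?oppr_eq0 -!pmulrn.
by rewrite h0E; apply: contraL p_gt => /(dvdn_leq nz_f0); rewrite -leqNgt.
Qed.

Definition evalp (R S : comNzRingType) (e : {rmorphism R -> S}) (x : S) :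
  {poly R} -> S := horner_eval x \o map_poly e.

HB.instance Definition _ (R S : comNzRingType) (e : {rmorphism R -> S}) (x : S)
  := GRing.RMorphism.copy (evalp e x) (horner_eval x \o map_poly e).

Lemma evalpE (R S : comNzRingType) (e : {rmorphism R -> S}) x p :
  evalp e x p = (map_poly e p).[x].
Proof. by []. Qed.

Lemma evalpC (R S : comNzRingType) (e : {rmorphism R -> S}) x c :
  evalp e x c%:P = e c.
Proof. by rewrite evalpE map_polyC hornerC. Qed.

Lemma evalpX (R S : comNzRingType) (e : {rmorphism R -> S}) x :
  evalp e x 'X = x.
Proof. by rewrite evalpE map_polyX hornerX. Qed.

Lemma evalpZ (R S : comNzRingType) (e : {rmorphism R -> S}) x c p :
  evalp e x (c *: p) = e c * evalp e x p.
Proof. by rewrite -mul_polyC rmorphM /= evalpC. Qed.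

Lemma finField_nonroot_ext (k : finFieldType) (p : {poly k}) : p != 0 ->
  exists (k' : finFieldType) (i : {rmorphism k -> k'}) (a : k'),
    (map_poly i p).[a] != 0.
Proof.
move=> nz_p; have szX: size ('X * p)%R = (size p).+1 by rewrite mulrC size_mulX.
have sz: (1 < size ('X * p - 1)%R)%N.
  by rewrite size_polyDl szX ?size_polyN ?size_poly1 ltnS size_poly_gt0.
have [k' [i [a rt_a]]] := finField_root_ext sz; exists k', i, a.
apply: contraL rt_a => /eqP p0.
rewrite rmorphB rmorphM /= map_polyX rmorph1 rootE !hornerE p0 mulr0 sub0r.
by rewrite oppr_eq0 oner_eq0.
Qed.

Lemma map_poly_trunc (R S : nzRingType) (e : {rmorphism R -> S}) (p : {poly R}) :
  exists2 q, map_poly e q = map_poly e p & size q = size (map_poly e p).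
Proof.
pose q := \poly_(i < size (map_poly e p)) p`_i.
have Dq: map_poly e q = map_poly e p.
  apply/polyP=> i; rewrite !coef_map coef_poly /=; case: ltnP => // le_i.
  by rewrite rmorph0 -coef_map nth_default.
exists q => //; apply/eqP; rewrite eqn_leq size_poly -Dq /=.
exact: size_poly.
Qed.

Lemma evalp_eq (R S : comNzRingType) (e : {rmorphism R -> S}) x p q :
  map_poly e p = map_poly e q -> evalp e x p = evalp e x q.
Proof. by rewrite !evalpE => ->. Qed.

Lemma map_poly_ker (R : comNzRingType) (S S' : nzRingType)
    (e : {rmorphism R -> S}) (h : {rmorphism R -> S'}) p :
  (forall r, e r = 0 -> h r = 0) -> map_poly e p = 0 -> map_poly h p = 0.
Proof.
move=> ker p0; apply/polyP=> i; rewrite coef_map coef0 /=; apply: ker.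
by rewrite -coef_map p0 coef0.
Qed.

(** If [x] is transcendental over the image of [e], keep the leading coefficient of [f] nonzero and
    send [x] to a non-root in a larger finite field. If [x] is algebraic, let [p] be a relation of
    least degree: some multiple of [f] takes at [x] the value of a nonzero constant [r], and [x] is
    sent to a root of the reduction of [p] under a homomorphism that kills neither [r] nor the
    leading coefficient of [p]. *)
Lemma separating_poly R (e : {rmorphism R -> F}) x :
  separating e -> separating (evalp e x).
Proof.
rewrite {2}/separating /= => sep f nz_f.
pose I p := evalp e x p = 0 /\ map_poly e p != 0.
have [[p0 Ip0]|trX] := pselect (exists p, I p); last first.
  have nz_ef: map_poly e f != 0.
    by apply: contraNneq nz_f => f0; rewrite evalpE f0 horner0.
  have nz_c: e f`_(size (map_poly e f)).-1 != 0.
    by rewrite -coef_map -lead_coefE lead_coef_eq0.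
  have [k [h [ker nz_h]]] := sep _ nz_c.
  have nz_hf: map_poly h f != 0.
    apply: contraNneq nz_h => hf0.
    by rewrite -coef_map hf0 coef0.
  have [k' [i [a nz_a]]] := finField_nonroot_ext nz_hf.
  exists k', (evalp (i \o h) a); split=> [r r0|]; last first.
    by rewrite /= evalpE map_poly_comp.
  have er0: map_poly e r = 0.
    by apply: contrapT => /eqP nz_r; apply: trX; exists r.
  rewrite /= evalpE map_poly_comp (map_poly_ker (h := h) ker er0) rmorph0.
  exact: horner0.
have [{p0 Ip0}p1 [p1_0 nz_p1] min_p1] :=
  ex_minimal (fun p => size (map_poly e p)) Ip0.
have [p Dp szp] := map_poly_trunc e p1.
have{p1_0} p_0: evalp e x p = 0 by rewrite (evalp_eq _ Dp).
have small q: evalp e x q = 0 -> (size (map_poly e q) < size p)%N ->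
    map_poly e q = 0.
  move=> q0; apply: contraTeq => nz_q; rewrite -leqNgt szp; exact: min_p1.
have nz_lp : e (lead_coef p) != 0.
  by rewrite lead_coefE szp -coef_map Dp -lead_coefE lead_coef_eq0.
have p_gt1: (1 < size p)%N.
  rewrite ltnNge; apply: contra nz_lp => /size1_polyC Dpc.
  by move: p_0; rewrite Dpc evalpC lead_coefC => ->.
have szle (q : {poly R}) : (size (map_poly e q) <= size q)%N by apply: size_poly.
(* Represents the nonzero multiples of the value of [f]. A representative of least degree turns out
   to be constant: pseudo-divide it by [p], then [p] by it. *)
pose W w := evalp e x w != 0 /\ exists u, evalp e x w = evalp e x u * evalp e x f.
have Wf: W f by split=> //; exists 1; rewrite rmorph1 mul1r.
have [w1 [nz_w1 [u Du]] min_w1] := ex_minimal (fun p => size (map_poly e p)) Wf.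
have [w Dw szw] := map_poly_trunc e w1.
rewrite -(evalp_eq _ Dw) in nz_w1 Du; rewrite -szw in min_w1.
have Dsw: size (map_poly e w) = size w by rewrite Dw.
have nz_w: map_poly e w != 0.
  by apply: contraNneq nz_w1 => w0; rewrite evalpE w0 horner0.
have nz_lw: e (lead_coef w) != 0.
  by rewrite lead_coefE -Dsw -coef_map -lead_coefE lead_coef_eq0.
have w_lt_p: (size w < size p)%N.
  have Dr := Pdiv.ComRing.rdivp_eq p w.
  have nz_p: p != 0 by rewrite -size_poly_gt0 ltnW.
  set r := Pdiv.Ring.rmodp w p in Dr.
  have Er: evalp e x r = e (lead_coef p) ^+ Pdiv.Ring.rscalp w p * evalp e x w.
    by rewrite -rmorphXn -evalpZ Dr rmorphD rmorphM /= p_0 mulr0 add0r.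
  have Wr: W r.
    rewrite /W Er mulf_neq0 ?expf_neq0 //; split=> //.
    exists ((lead_coef p ^+ Pdiv.Ring.rscalp w p) *: u).
    by rewrite evalpZ Du rmorphXn mulrA.
  apply: leq_ltn_trans (min_w1 _ Wr) _; apply: leq_ltn_trans (szle _) _.
  by rewrite Pdiv.Ring.ltn_rmodp.
have w_le1: (size w <= 1)%N.
  rewrite leqNgt; apply/negP => w_gt1.
  have Dr := Pdiv.ComRing.rdivp_eq w p.
  have nz_w0: w != 0 by rewrite -size_poly_gt0 ltnW.
  set r := Pdiv.Ring.rmodp p w in Dr; set q := Pdiv.Ring.rdivp p w in Dr.
  have lt_rw: (size r < size w)%N by rewrite Pdiv.Ring.ltn_rmodp.
  have Er: evalp e x r = - evalp e x q * evalp e x w.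
    apply/eqP; rewrite mulNr -subr_eq0 opprK addrC -rmorphM -rmorphD -Dr /=.
    by rewrite evalpZ p_0 mulr0.
  have r0: evalp e x r = 0.
    apply: contrapT => /eqP nz_r; suffices /min_w1: W r.
      by rewrite leqNgt (leq_ltn_trans (szle _)).
    by split=> //; exists (- q * u); rewrite Er rmorphM rmorphN /= Du mulrA.
  have q0: evalp e x q = 0.
    move/eqP: Er; rewrite r0 eq_sym mulf_eq0 (negPf nz_w1) orbF oppr_eq0.
    by move/eqP.
  move/(congr1 (map_poly e)): Dr; rewrite map_polyZ rmorphD rmorphM /= => Dr.
  have sz_l: size (e (lead_coef w ^+ Pdiv.Ring.rscalp p w) *: map_poly e p)
     = size p.
    by rewrite size_scale ?rmorphXn ?expf_neq0 // Dp -szp.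
  have lt_er: (size (map_poly e r) < size w)%N by apply: leq_ltn_trans (szle _) _.
  (* As [q] vanishes at [x], it is zero over [F] unless its degree reaches that of [p], in which
     case [q * w] would have too large a degree. Then [p] equals [r] up to a nonzero factor, which
     is too short. *)
  have eq0: map_poly e q = 0.
    apply: small => //; rewrite ltnNge; apply/negP => le_pq.
    have nz_q: map_poly e q != 0 by rewrite -size_poly_gt0 (leq_trans _ le_pq) // ltnW.
    have szqw: size (map_poly e q * map_poly e w)%R
             = (size (map_poly e q) + (size w).-1)%N.
      by rewrite size_mul // Dsw -[in LHS](prednK (ltnW w_gt1)) addnS.
    have w1_gt0: (0 < (size w).-1)%N by rewrite -ltnS (prednK (ltnW w_gt1)).
    have: (size p < size (map_poly e q * map_poly e w)%R)%N.
      by rewrite szqw -addn1 leq_add.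
    rewrite -sz_l Dr size_polyDl ?ltnn //; apply: leq_trans lt_er _.
    by rewrite szqw -[size w](prednK (ltnW w_gt1)) -addn1 addnC leq_add2r lt0n size_poly_eq0.
  move: sz_l; rewrite Dr eq0 mul0r add0r => sz_l.
  by move: lt_er; rewrite sz_l ltnNge ltnW.
have{w_le1} [r Dwr] : exists r, w = r%:P.
  by exists w`_0; apply: size1_polyC.
have nz_cr: e (lead_coef p * r) != 0.
  by rewrite rmorphM mulf_neq0 //; move: nz_w1; rewrite Dwr evalpC.
have [k [h [ker]]] := sep _ nz_cr.
rewrite rmorphM mulf_eq0 => /norP[nz_hp nz_hr].
have sz_hp: (1 < size (map_poly h p))%N by rewrite size_poly_eq.
have [k' [i [a rt_a]]] := finField_root_ext sz_hp.
pose ih : {rmorphism R -> k'} := i \o h.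
have ihP: evalp ih a p = 0 by apply/eqP; rewrite evalpE map_poly_comp.
have kerih q: e q = 0 -> ih q = 0 by move=> /ker /= ->; rewrite rmorph0.
exists k', (evalp ih a).
(* Pseudo-division by [p] leaves a remainder that vanishes at [x] and is too short to be a nonzero
   relation; the power of the leading coefficient that it introduces is not killed by [ih]. *)
have kerx q: evalp e x q = 0 -> evalp ih a q = 0.
  move=> q0; have Dr := Pdiv.ComRing.rdivp_eq p q.
  have nz_p: p != 0 by rewrite -size_poly_gt0 ltnW.
  set s := Pdiv.Ring.rmodp q p in Dr.
  have s0: map_poly e s = 0.
    apply: small; last by apply: leq_ltn_trans (szle _) _; rewrite Pdiv.Ring.ltn_rmodp.
    move/(congr1 (evalp e x)): Dr.
    by rewrite evalpZ q0 rmorphD rmorphM /= p_0 !mulr0 add0r.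
  move/(congr1 (evalp ih a)): Dr.
  rewrite evalpZ rmorphD rmorphM /= ihP mulr0 add0r [RHS]evalpE.
  rewrite (map_poly_ker (h := ih) kerih s0) horner0 => /eqP.
  by rewrite mulf_eq0 /= !rmorphXn expf_eq0 fmorph_eq0 (negPf nz_hp) andbF => /eqP.
split=> //; apply: contraNneq nz_hr => f0.
have: evalp ih a (w - u * f) = 0.
  by apply: kerx; rewrite rmorphB rmorphM /= Du subrr.
by rewrite rmorphB rmorphM /= f0 mulr0 subr0 Dwr evalpC => /eqP; rewrite fmorph_eq0.
Qed.

Lemma separating_subring (s : seq F) :
  exists (R : comNzRingType) (e : {rmorphism R -> F}),
    separating e /\ forall x, x \in s -> exists r, e r = x.
Proof.
elim: s => [|x s [R [e [sep surj]]]].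
  by exists int, (intr : {rmorphism int -> F}); split=> //; apply: separating_int.
exists {poly R}, (evalp e x); split=> [|y]; first exact: separating_poly.
rewrite inE => /predU1P[->|/surj[r <-]]; first by exists 'X; rewrite /= evalpX.
by exists r%:P; rewrite /= evalpC.
Qed.

(* A ring homomorphism from the subring [pval pring] of [F] to a finite field. *)
Record place := Place {
  pring : comNzRingType;
  pres : finFieldType;
  pval : {rmorphism pring -> F};
  preduce : {rmorphism pring -> pres};
  pker : forall r, pval r = 0 -> preduce r = 0 }.

Definition specializes (P : place) (x : F) (a : pres P) :=
  exists2 r, pval P r = x & preduce P r = a.

Definition place_ext (P P' : place) (i : {rmorphism pres P -> pres P'}) :=
  forall x a, @specializes P x a -> @specializes P' x (i a).

(** * Extension of places to further elements of the field *)

Section Extension.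
Variable P : place.
Local Notation R := (pring P).
Local Notation e := (pval P).
Local Notation h := (preduce P).

(* The reductions of the polynomials vanishing at [z] form an ideal of the
   polynomials over the image of [h], generated by any nonzero element of
   minimal degree. *)
Lemma root_or_unit (z : F) :
  (exists (k : finFieldType) (i : {rmorphism pres P -> k}) (a : k),
     forall p, evalp e z p = 0 -> evalp (i \o h) a p = 0)
  \/ exists2 p, evalp e z p = 0 & map_poly h p = 1.
Proof.
pose I p := evalp e z p = 0 /\ map_poly h p != 0.
have [[p0 Ip0]|noI] := pselect (exists p, I p); last first.
  left; exists (pres P), idfun, 0 => p p0.
  have hp0: map_poly h p = 0.
    by apply: contrapT => /eqP nz_p; apply: noI; exists p.
  by rewrite evalpE (map_poly_comp idfun) hp0 rmorph0 horner0.
have [{p0 Ip0}p [p_0 nz_p] min_p] :=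
  ex_minimal (fun p => size (map_poly h p)) Ip0.
have nz_l: h p`_(size (map_poly h p)).-1 != 0.
  by rewrite -coef_map -lead_coefE lead_coef_eq0.
(* The inverse of the leading coefficient [h l] is a power of it, so it lifts to [b] in [R], and
   Euclidean division by the reduction of [p] can be done on lifts. *)
set l := p`__ in nz_l; have [N DN] := finField_inv_exp nz_l.
pose b := l ^+ N; have Db: h (b * l) = 1 by rewrite rmorphM rmorphXn.
have [p_le1|p_gt1] := leqP (size (map_poly h p)) 1.
  right; exists (b *: p); first by rewrite evalpZ p_0 mulr0.
  have Dhp: map_poly h p = (h l)%:P.
    rewrite [LHS]size1_polyC // /l coef_map /=; congr (h (nth _ _ _))%:P.
    by case: (size _) p_le1 => [|[]].
  by rewrite map_polyZ Dhp -mul_polyC -polyCM -rmorphM Db.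
left; have [k [i [a rt_a]]] := finField_root_ext p_gt1.
exists k, i, a => q q_0; rewrite evalpE map_poly_comp.
suffices dvq: map_poly h p %| map_poly h q.
  have /dvdpP[v ->] := dvq; rewrite rmorphM /= hornerM.
  by rewrite (rootP rt_a) mulr0.
have [n] := ubnP (size (map_poly h q)); elim: n q q_0 => // n IHn q q_0.
rewrite ltnS => le_qn; have [->|nz_q] := eqVneq (map_poly h q) 0.
  exact: dvdp0.
have le_pq: (size (map_poly h p) <= size (map_poly h q))%N by apply: min_p.
pose c := q`_(size (map_poly h q)).-1.
pose d := (size (map_poly h q) - size (map_poly h p))%N.
(* One division step: [q'] still vanishes at [z], and its reduction has lost the leading term of
   that of [q]. *)
pose q' : {poly R} := q - (c * b) *: ('X^d * p).
have Dq: map_poly h q = map_poly h q' + h (c * b) *: ('X^d * map_poly h p).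
  by rewrite rmorphB /= map_polyZ (rmorphM (map_poly h)) /= map_polyXn subrK.
rewrite Dq dvdp_addl; last by rewrite -mul_polyC !dvdp_mull.
apply: IHn.
  by rewrite rmorphB /= evalpZ (rmorphM (evalp e z)) /= p_0 q_0 !mulr0 subr0.
apply: leq_trans le_qn; rewrite -(prednK (_ : 0 < size (map_poly h q))%N);
  last by rewrite size_poly_gt0.
rewrite ltnS; apply/leq_sizeP => j le_qj.
have [lt_qj|] := ltnP (size (map_poly h q)).-1 j.
  move/(congr1 (fun p : {poly _} => p`_j)): Dq.
  rewrite coefD coefZ coefXnM nth_default; last first.
    by rewrite -ltnS prednK ?size_poly_gt0 // in lt_qj *.
  case: ifP => [_|/negbT]; first by rewrite mulr0 addr0.
  rewrite -leqNgt => le_dj; rewrite [X in _ * X]nth_default ?mulr0 ?addr0 //.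
  rewrite leq_subRL // /d subnK //.
  by rewrite -ltnS prednK ?size_poly_gt0 // in lt_qj *.
move=> le_jq; have {le_jq le_qj}-> : j = (size (map_poly h q)).-1.
  by apply/eqP; rewrite eqn_leq le_jq.
rewrite coef_map coefB coefZ coefXnM.
have sz_p: (0 < size (map_poly h p))%N by rewrite size_poly_gt0.
case: ifP => [|_]; first by rewrite ltnNge /d -subn1 leq_sub2l.
have ->: ((size (map_poly h q)).-1 - d)%N = (size (map_poly h p)).-1.
  by rewrite /d -!subn1 subnAC subKn.
by rewrite -mulrA -/c -/l /= rmorphB rmorphM /= Db mulr1 subrr.
Qed.

(* A relation of unit reduction satisfied by [x] and one satisfied by its
   inverse can be played against each other to lower the degrees. *)
Lemma unit_relations_absurd (x : F) (p q : {poly R}) u v : x != 0 ->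
    evalp e x p = 0 -> evalp e x^-1 q = 0 ->
    map_poly h p = u%:P -> map_poly h q = v%:P -> u != 0 -> v != 0 -> False.
Proof.
have [n] := ubnP (size p + size q)%N.
elim: n => // n IHn in x p q u v *; rewrite ltnS.
wlog le_qp: x p q u v / (size q <= size p)%N => [IHw|].
  case: (leqP (size q) (size p)) => [|/ltnW] le_pq; first exact: IHw le_pq.
  rewrite addnC => le_n nz_x p0 q0 hp hq nz_u nz_v.
  by apply: (IHw x^-1 q p v u); rewrite ?invr_eq0 ?invrK.
move=> le_n nz_x p0 q0 hp hq nz_u nz_v.
have q_gt1: (1 < size q)%N.
  rewrite ltnNge; apply/negP => /size1_polyC Dq; case/eqP: nz_v.
  move: q0 hq; rewrite Dq evalpC map_polyC => /pker h0 /polyC_inj <-.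
  exact: h0.
set d := (size p).-1; set d' := (size q).-1.
have Dp: size p = d.+1 by rewrite prednK // (leq_trans _ le_qp) // ltnW.
have Dq: size q = d'.+1 by rewrite prednK // ltnW.
have le_d: (d' <= d)%N by rewrite -ltnS -Dp -Dq.
have d'_gt0: (0 < d')%N by rewrite -ltnS -Dq.
have d_gt0: (0 < d)%N := leq_trans d'_gt0 le_d.
(* The reciprocal polynomial of [q]: its value at [x] is [x ^+ d'] times that of [q] at [x^-1],
   hence zero. *)
pose qs := \poly_(j < d'.+1) q`_(d' - j).
have qs0: evalp e x qs = 0.
  rewrite evalpE (@horner_coef_wide _ d'.+1); last first.
    by rewrite (leq_trans (size_poly _ _)) // size_poly.
  transitivity (x ^+ d' * evalp e x^-1 q); last by rewrite q0 mulr0.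
  rewrite evalpE (@horner_coef_wide _ d'.+1); last first.
    by rewrite (leq_trans (size_poly _ _)) // Dq.
  rewrite mulr_sumr (reindex_inj rev_ord_inj) /=; apply: eq_bigr => j _.
  have le_j: (j <= d')%N by rewrite -ltnS.
  rewrite subSS [in LHS]coef_map coef_poly ltnS leq_subr (subKn le_j) coef_map.
  rewrite mulrCA; congr (_ * _).
  by rewrite exprVn expfB_cond // (negPf nz_x).
(* The terms of degree [d] cancel. Since [d > 0], the coefficient of [p] in degree [d] reduces to
   [0], so [p'] still reduces to a nonzero constant, [v * u]. *)
pose p' : {poly R} := q`_0 *: p - p`_d *: ('X^(d - d') * qs).
have hpd: h p`_d = 0.
  by rewrite -coef_map hp coefC gtn_eqF.
have hq0: h q`_0 = v by rewrite -coef_map hq coefC.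
apply: (IHn x p' q (v * u) v) => //; last by rewrite mulf_neq0.
- apply: leq_trans le_n; rewrite ltn_add2r Dp ltnS; apply/leq_sizeP => j le_dj.
  rewrite coefB !coefZ coefXnM ltnNge (leq_trans (leq_subr _ _) le_dj) /=.
  rewrite coef_poly ltnS leq_subLR subnK //.
  have [le_jd|lt_dj] := leqP j d; last by rewrite [p`_j]nth_default ?Dp //= !mulr0 subr0.
  have ->: j = d by apply/eqP; rewrite eqn_leq le_jd.
  by rewrite subKn // subnn mulrC subrr.
- by rewrite rmorphB /= !evalpZ (rmorphM (evalp e x)) /= p0 qs0 !mulr0 subr0.
by rewrite rmorphB /= !map_polyZ hpd scale0r subr0 hp hq0 -mul_polyC -polyCM.
Qed.

(** Chevalley's argument: if neither [x] nor [x^-1] could be given a value, both would satisfy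
    relations that reduce to [1], against [unit_relations_absurd]. *)
Lemma place_adjoin (x : F) : x != 0 ->
  exists P' (i : {rmorphism pres P -> pres P'}), place_ext i /\
    exists a, @specializes P' x a \/ @specializes P' x^-1 a.
Proof.
move=> nz_x.
have ext z : (exists (k : finFieldType) (i : {rmorphism pres P -> k}) (a : k),
      forall p, evalp e z p = 0 -> evalp (i \o h) a p = 0) ->
    exists P' (i : {rmorphism pres P -> pres P'}), place_ext i /\
      exists a, @specializes P' z a.
  move=> [k [i [a ker]]].
  exists (@Place _ k (evalp e z) (evalp (i \o h) a) ker), i; split.
    by move=> y b [r <- <-]; exists r%:P; rewrite /= evalpC.
  by exists a, 'X; rewrite /= evalpX.
have [/ext[P' [i [Pi [a Pa]]]]|[p p0 hp]] := root_or_unit x.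
  by exists P', i; split=> //; exists a; left.
have [/ext[P' [i [Pi [a Pa]]]]|[q q0 hq]] := root_or_unit x^-1.
  by exists P', i; split=> //; exists a; right.
by case: (unit_relations_absurd nz_x p0 q0 hp hq); apply: oner_neq0.
Qed.

End Extension.

Lemma specializes_inj P x (a b : pres P) :
  specializes x a -> specializes x b -> a = b.
Proof.
move=> [r Dr <-] [s Ds <-]; apply/eqP; rewrite -subr_eq0 -rmorphB.
by rewrite pker // rmorphB /= Dr Ds subrr.
Qed.

Lemma specializes1 P : @specializes P 1 1.
Proof. by exists 1; rewrite rmorph1. Qed.

Lemma specializes0 P : @specializes P 0 0.
Proof. by exists 0; rewrite rmorph0. Qed.

Lemma specializesM P x y (a b : pres P) :
  specializes x a -> specializes y b -> specializes (x * y) (a * b).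
Proof. by move=> [r <- <-] [s <- <-]; exists (r * s); rewrite rmorphM. Qed.

(** This divides the family by a dominant member, found one element at a time: [place_adjoin]
    decides whether the scale is still set by [c] or now by the new element [x]. *)
Lemma place_normalize P (s : seq F) : (exists2 y, y \in s & y != 0) ->
  exists P' (i : {rmorphism pres P -> pres P'}), place_ext i /\
    exists c, [/\ c != 0, forall y, y \in s -> exists a, @specializes P' (c * y) a
                & exists2 y, y \in s & c * y = 1].
Proof.
elim: s => [[]//|x s IHs]; have [nz_s _|z_s] := pselect (exists2 y, y \in s & y != 0);
  last first.
  case=> y; rewrite inE => /predU1P[->|sy] nz_y; last by case: z_s; exists y.
  exists P, idfun; split=> //; exists x^-1; split; rewrite ?invr_eq0 //.
    move=> z; rewrite inE => /predU1P[->|sz].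
      by exists 1; rewrite mulVf //; apply: specializes1.
    exists 0; rewrite (_ : z = 0) ?mulr0; first exact: specializes0.
    by apply: contrapT => /eqP nz_z; case: z_s; exists z.
  by exists x; rewrite ?mem_head ?mulVf.
have [P1 [i [Pi [c [nz_c cP [y sy Dy]]]]]] := IHs nz_s.
have [->|nz_x] := eqVneq x 0.
  exists P1, i; split=> //; exists c; split=> //; last first.
    by exists y; rewrite // inE sy orbT.
  move=> z; rewrite inE => /predU1P[->|/cP//].
  by exists 0; rewrite mulr0; apply: specializes0.
have [P2 [j [Pj [a Pa]]]] := place_adjoin P1 (mulf_neq0 nz_c nz_x).
exists P2, (j \o i); split=> [z b /Pi/Pj //|]; case: Pa => Pa.
  exists c; split=> //; last by exists y; rewrite // inE sy orbT.
  move=> z; rewrite inE => /predU1P[->|/cP[b /Pj Pb]]; first by exists a.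
  by exists (j b).
exists x^-1; split; rewrite ?invr_eq0 //; last by exists x; rewrite ?mem_head ?mulVf.
move=> z; rewrite inE => /predU1P[->|/cP[b /Pj Pb]].
  by exists 1; rewrite mulVf //; apply: specializes1.
exists (a * j b); have <-: (c * x)^-1 * (c * z) = x^-1 * z.
  by rewrite invfM mulrACA mulVf // mul1r.
exact: specializesM.
Qed.

Lemma place_exists (s : seq F) :
  exists P : place, forall x, x \in s -> exists a, @specializes P x a.
Proof.
have [R [e [sep surj]]] := separating_subring s.
have [|k [h [ker _]]] := sep 1; first by rewrite rmorph1 oner_neq0.
by exists (Place ker) => x /surj[r <-]; exists (h r), r.
Qed.

(** A single lift of the whole matrix makes products, determinants and adjugates reduce through
    [map_mx]; [mxspecP] gives the entrywise form. *)
Definition mxspec (P : place) m n (X : 'M[F]_(m, n)) (Y : 'M[pres P]_(m, n)) :=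
  exists2 Z, map_mx (pval P) Z = X & map_mx (preduce P) Z = Y.

Lemma mxspecP P m n (X : 'M[F]_(m, n)) (Y : 'M[pres P]_(m, n)) :
  mxspec X Y <-> forall i j, specializes (X i j) (Y i j).
Proof.
split=> [[Z <- <-] i j|sXY]; first by exists (Z i j); rewrite !mxE.
have /choice[z zP] (ij : 'I_m * 'I_n) : exists r,
    pval P r = X ij.1 ij.2 /\ preduce P r = Y ij.1 ij.2.
  by have [r] := sXY ij.1 ij.2; exists r.
exists (\matrix_(i, j) z (i, j)); apply/matrixP => i j; rewrite !mxE.
  by case: (zP (i, j)).
by case: (zP (i, j)).
Qed.

Lemma mxspec_total P m n (X : 'M[F]_(m, n)) :
  (forall i j, exists a, @specializes P (X i j) a) -> exists Y, @mxspec P m n X Y.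
Proof.
move=> sX; have /choice[y yP] (ij : 'I_m * 'I_n) := sX ij.1 ij.2.
exists (\matrix_(i, j) y (i, j)); apply/mxspecP => i j; rewrite mxE.
exact: (yP (i, j)).
Qed.

Lemma mxspec_inj P m n (X : 'M[F]_(m, n)) (Y Y' : 'M[pres P]_(m, n)) :
  mxspec X Y -> mxspec X Y' -> Y = Y'.
Proof.
move=> /mxspecP sY /mxspecP sY'; apply/matrixP => i j.
exact: specializes_inj (sY i j) (sY' i j).
Qed.

Lemma mxspecM P m n p (X : 'M[F]_(m, n)) (X' : 'M[F]_(n, p)) Y (Y' : 'M[pres P]_(n, p)) :
  mxspec X Y -> mxspec X' Y' -> mxspec (X *m X') (Y *m Y').
Proof. by move=> [Z <- <-] [Z' <- <-]; exists (Z *m Z'); rewrite map_mxM. Qed.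

Lemma mxspecB P m n (X X' : 'M[F]_(m, n)) Y (Y' : 'M[pres P]_(m, n)) :
  mxspec X Y -> mxspec X' Y' -> mxspec (X - X') (Y - Y').
Proof. by move=> [Z <- <-] [Z' <- <-]; exists (Z - Z'); rewrite map_mxB. Qed.

Lemma mxspec_scalar P m x (a : pres P) :
  specializes x a -> mxspec (x%:M : 'M_m) a%:M.
Proof. by move=> [r <- <-]; exists r%:M; rewrite map_scalar_mx. Qed.

Lemma mxspec_det P m (X : 'M[F]_m) (Y : 'M[pres P]_m) :
  mxspec X Y -> specializes (\det X) (\det Y).
Proof. by move=> [Z <- <-]; exists (\det Z); rewrite det_map_mx. Qed.

Lemma mxspec_adj P m (X : 'M[F]_m) (Y : 'M[pres P]_m) :
  mxspec X Y -> mxspec (\adj X) (\adj Y).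
Proof. by move=> [Z <- <-]; exists (\adj Z); rewrite map_mx_adj. Qed.

Lemma mxspec_ext P P' (i : {rmorphism pres P -> pres P'}) m n
    (X : 'M[F]_(m, n)) (Y : 'M[pres P]_(m, n)) :
  place_ext i -> mxspec X Y -> mxspec X (map_mx i Y).
Proof.
by move=> Pi /mxspecP sXY; apply/mxspecP => j l; rewrite mxE; apply: Pi.
Qed.

End Places.

(** * Finite simple rings *)

(** Wedderburn's little theorem for a division ring [C] inside [M] whose identity [e] need not be
    that of [M]; hence [C] is first made into a ring type of its own, with [e] as its one. *)
Lemma finite_corner_commutative (M : finNzRingType) (C : {pred M}) (e : M) :
    e \in C -> e != 0 ->
    (forall x y, x \in C -> y \in C -> x - y \in C) ->
    (forall x y, x \in C -> y \in C -> x * y \in C) ->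
    (forall x, x \in C -> e * x = x) -> (forall x, x \in C -> x * e = x) ->
    (forall x, x \in C -> x != 0 -> exists2 y, y \in C & x * y = e /\ y * x = e) ->
  forall x y, x \in C -> y \in C -> x * y = y * x.
Proof.
move=> Ce nz_e CB CM e1 e1r CV.
have C0: 0 \in C by rewrite -(subrr e) CB.
have CN x: x \in C -> - x \in C by move=> Cx; rewrite -sub0r CB.
have CD x y: x \in C -> y \in C -> x + y \in C.
  by move=> Cx Cy; rewrite -[y]opprK CB ?CN.
pose W := {x | x \in C}.
pose mk (x : M) (Cx : x \in C) : W := exist (fun x => x \in C) x Cx.
pose W0 : W := mk _ C0.
pose Wopp (x : W) : W := mk _ (CN _ (valP x)).
pose Wadd (x y : W) : W := mk _ (CD _ _ (valP x) (valP y)).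
pose W1 : W := mk _ Ce.
pose Wmul (x y : W) : W := mk _ (CM _ _ (valP x) (valP y)).
have addA: associative Wadd by move=> x y z; apply/val_inj/addrA.
have addC: commutative Wadd by move=> x y; apply/val_inj/addrC.
have add0: left_id W0 Wadd by move=> x; apply/val_inj/add0r.
have addN: left_inverse W0 Wopp Wadd by move=> x; apply/val_inj/addNr.
have mulA: associative Wmul by move=> x y z; apply/val_inj/mulrA.
have mul1: left_id W1 Wmul by move=> x; apply/val_inj/e1/valP.
have mulr1: right_id W1 Wmul by move=> x; apply/val_inj/e1r/valP.
have mulDl: left_distributive Wmul Wadd by move=> x y z; apply/val_inj/mulrDl.
have mulDr: right_distributive Wmul Wadd by move=> x y z; apply/val_inj/mulrDr.
have W10: W1 != W0 by apply: contra nz_e => /eqP[->].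
have WV (x : W) : {y | if x == W0 then y = W0 else Wmul y x = W1 /\ Wmul x y = W1}.
  apply: cid; have [_|nz_x] := eqVneq; first by exists W0.
  have [|y Cy [xy yx]] := CV _ (valP x).
    by apply: contraNneq nz_x => x0; apply/eqP/val_inj.
  by exists (mk y Cy); split; apply: val_inj.
pose zM := GRing.isZmodule.Build W addA addC add0 addN.
pose zT : zmodType := HB.pack W zM.
pose rM := GRing.Zmodule_isNzRing.Build zT mulA mul1 mulr1 mulDl mulDr W10.
pose rT : nzRingType := HB.pack W zM rM.
pose Winv (x : rT) : rT := sval (WV x).
pose Wunit := [pred x : rT | x != W0].
have mulVx: {in Wunit, left_inverse 1 Winv *%R}.
  move=> x /negPf nz_x; rewrite /Winv; case: (WV x) => y /=.
  by rewrite nz_x => -[].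
have mulxV: {in Wunit, right_inverse 1 Winv *%R}.
  move=> x /negPf nz_x; rewrite /Winv; case: (WV x) => y /=.
  by rewrite nz_x => -[].
have unitPl (x y : rT) : y * x = 1 /\ x * y = 1 -> Wunit x.
  move=> [yx _]; apply/eqP => x0; have := oner_neq0 rT.
  by rewrite -yx x0 [y * _](mulr0 (y : rT)) eqxx.
have inv_out: {in predC Wunit, Winv =1 id}.
  move=> x; rewrite !inE negbK => x0; rewrite /Winv; case: (WV x) => y /=.
  by rewrite x0 => ->; rewrite (eqP x0).
pose uM := GRing.NzRing_hasMulInverse.Build rT mulVx mulxV unitPl inv_out.
pose uT : finUnitRingType := HB.pack W zM rM uM.
have dom: GRing.integral_domain_axiom uT.
  move=> x y xy0; apply/norP => -[nz_x nz_y]; case/eqP: nz_y.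
  by rewrite -[y]mul1r -(mulVx x nz_x) -mulrA [x * y]xy0 mulr0.
move=> x y Cx Cy.
by have /(congr1 val) := finDomain_mulrC dom (mk x Cx) (mk y Cy).
Qed.

Lemma finite_idempotent_power (M : finNzRingType) (z : M) :
  exists2 N, (0 < N)%N & z ^+ N * z ^+ N = z ^+ N.
Proof.
have /injectivePn[i [j neq_ij Dij]] :
    ~~ injectiveb (fun i : 'I_(#|M|.+1) => z ^+ i).
  apply/negP => /injectiveP/leq_card; by rewrite card_ord ltnn.
wlog lt_ij: i j neq_ij Dij / (i < j)%N => [IH|].
  have [lt_ij|lt_ji|/val_inj eq_ij] := ltngtP i j; first exact: (IH i j).
    by apply: (IH j i); rewrite // eq_sym.
  by rewrite eq_ij eqxx in neq_ij.
pose p := (j - i)%N; have p_gt0: (0 < p)%N by rewrite subn_gt0.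
have step n : (i <= n)%N -> z ^+ (n + p) = z ^+ n.
  move=> le_in; rewrite -(subnK le_in) -addnA /p (subnKC (ltnW lt_ij)).
  by rewrite !exprD Dij.
have per n k : (i <= n)%N -> z ^+ (n + p * k) = z ^+ n.
  move=> le_in; elim: k => [|k IHk]; first by rewrite muln0 addn0.
  by rewrite mulnS [(p + _)%N]addnC addnA step // (leq_trans le_in) ?leq_addr.
(* A multiple of the period [p], large enough for the powers to have become periodic, so that
   doubling it changes nothing. *)
exists (p * i.+1)%N; first by rewrite muln_gt0 p_gt0.
by rewrite -exprD per // (leq_trans (leqnSn i)) // leq_pmull.
Qed.

Section FiniteSimple.
Variables (k : finFieldType) (m : nat).
Local Notation M := 'M[k]_m.+1.
Variable B : M -> Prop.
Hypothesis B1 : B 1.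
Hypothesis BB : forall x y, B x -> B y -> B (x - y).
Hypothesis BM : forall x y, B x -> B y -> B (x * y).
Hypothesis Bsimple : forall b, B b -> b != 0 ->
  exists2 l : seq (M * M), (forall p, p \in l -> B p.1 /\ B p.2) &
    \sum_(p <- l) p.1 * b * p.2 = 1.
Hypothesis Bcenter : forall z, B z -> (forall y, B y -> z * y = y * z) ->
  exists a : k, z = a *: 1.

Let B0 : B 0. Proof. by rewrite -(subrr 1); apply: BB. Qed.
Let BN x : B x -> B (- x). Proof. by move=> Bx; rewrite -sub0r; apply: BB. Qed.
Let BD x y : B x -> B y -> B (x + y).
Proof. by move=> Bx By; rewrite -[y]opprK; apply/BB/BN. Qed.
Let BX x n : B x -> B (x ^+ n).
Proof. by move=> Bx; elim: n => // n IHn; rewrite exprS; apply: BM. Qed.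
Let Bsum (I : Type) (r : seq I) (E : I -> M) :
  (forall i, B (E i)) -> B (\sum_(i <- r) E i).
Proof. by move=> BE; elim/big_ind: _. Qed.

(** The primitive idempotents of [B]. *)
Definition minimal_idempotent (e : M) := [/\ B e, e * e = e, e != 0 &
  forall f, B f -> f * f = f -> f != 0 -> e * f = f -> f * e = f -> f = e].

Definition corner (e z : M) := [/\ B z, e * z = z & z * e = z].

(** The count is the size of the right ideal [e M]; a smaller idempotent of [B] would generate a
    smaller ideal. *)
Lemma minimal_idempotent_exists : exists e, minimal_idempotent e.
Proof.
pose P e := [/\ B e, e * e = e & e != 0].
have P1: P 1 by split; rewrite ?mulr1 ?oner_neq0.
have [e [Be ee nz_e] min_e] := ex_minimal (fun e : M => #|[pred x | e * x == x]|) P1.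
exists e; split=> // f Bf ff nz_f ef fe.
have sub: [pred x | f * x == x] \subset [pred x | e * x == x].
  by apply/subsetP => x; rewrite !inE => /eqP <-; rewrite mulrA ef.
have /subset_cardP eq_fe: #|[pred x | f * x == x]| = #|[pred x | e * x == x]|.
  by apply/eqP; rewrite eqn_leq subset_leq_card // min_e.
by have := eq_fe sub e; rewrite !inE ee eqxx fe => /eqP.
Qed.

Section Corner.
Variable e : M.
Hypothesis mi_e : minimal_idempotent e.
Let Be : B e. Proof. by case: mi_e. Qed.
Let ee : e * e = e. Proof. by case: mi_e. Qed.
Let nz_e : e != 0. Proof. by case: mi_e. Qed.

Let cornerM x y : corner e x -> corner e y -> corner e (x * y).
Proof.
by move=> [Bx ex xe] [By ey ye]; split; rewrite ?mulrA ?ex -?mulrA ?ye //; apply: BM.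
Qed.

Let corner_mid x : B x -> corner e (e * x * e).
Proof.
move=> Bx; split; rewrite ?mulrA ?ee // -?mulrA ?ee //.
by apply: BM => //; apply: BM.
Qed.

Let cornerX z n : corner e z -> corner e (z ^+ n.+1).
Proof. by move=> Cz; elim: n => [|n IHn] //; rewrite exprS; apply: cornerM. Qed.

Let corner_idem f : corner e f -> f * f = f -> f != 0 -> f = e.
Proof. by case: mi_e => _ _ _ min [Bf ef fe] ff nz_f; apply: min. Qed.

Let corner_pow z : corner e z -> exists n, z ^+ n.+1 = 0 \/ z ^+ n.+1 = e.
Proof.
move=> Cz; have [[//|n] _ idn] := finite_idempotent_power z; exists n.
have [|nz] := eqVneq (z ^+ n.+1) 0; [by left | right].
exact: corner_idem (cornerX n Cz) idn nz.
Qed.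

Let nilpotent_ideal_proper z n (l : seq (M * M)) :
    corner e z -> z ^+ n.+1 = 0 ->
    (forall p, p \in l -> corner e p.1 /\ corner e p.2) ->
  \sum_(p <- l) p.1 * z * p.2 <> e.
Proof.
move=> Cz zn0; have [s] := ubnP (size l); elim: s l => // s IHs [|[p q] l] /=.
  by rewrite big_nil => _ _ e0; case/eqP: (nz_e).
rewrite ltnS => le_s Cl; rewrite big_cons /=; set x := p * z * q; set S := \sum_(_ <- _) _.
have [Cp Cq]: corner e p /\ corner e q by apply: (Cl (p, q)); rewrite mem_head.
have Cx: corner e x by apply: cornerM => //; apply: cornerM.
have [Bz ez ze] := Cz; have [Bp ep pe] := Cp; have [Bq eq qe] := Cq.
have [Bx ex xe] := Cx.
have [n' [xn0|xne]] := corner_pow Cx => De.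
  pose v := (\sum_(j < n'.+1) x ^+ j) * e.
  have Bv: B v by apply: BM => //; apply: Bsum => j; apply: BX.
  have ve: v * e = v by rewrite -mulrA ee.
  have De2: S * v = e.
    have ->: S = e * (1 - x) by rewrite mulrBr mulr1 ex -De addrC addKr.
    have := subrX1 x n'.+1; rewrite xn0 sub0r => /(congr1 -%R).
    rewrite opprK -mulNr opprB => /esym D1.
    by rewrite /v mulrA -[e * _ * _]mulrA D1 mulr1 ee.
  apply: (IHs [seq (pq.1, pq.2 * v) | pq <- l]); first by rewrite size_map.
    move=> pq /mapP[[p1 q1] lpq ->] /=.
    have [C1 [Bq1 eq1 qe1]]: corner e p1 /\ corner e q1.
      by apply: (Cl (p1, q1)); rewrite inE lpq orbT.
    by split=> //; split; [apply: BM | rewrite mulrA eq1 | rewrite -mulrA ve].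
  rewrite big_map -[RHS]De2 mulr_suml; apply: eq_bigr => pq _ /=.
  by rewrite !mulrA.
pose w := q * x ^+ n'.
have De1: p * z * w = e by rewrite /w mulrA -/x -exprS.
have [Bw ew]: B w /\ e * w = w.
  by split; [apply/BM/BX | rewrite /w mulrA eq].
(* From [p z w = e], this is a nonzero idempotent of the corner, hence [e] by minimality; so [w p]
   is a right inverse of [z]. *)
pose f := z * (w * p).
have ff: f * f = f.
  have ->: f * f = z * w * (p * z * w) * p by rewrite /f !mulrA.
  by rewrite De1 /f -!mulrA ep.
have nz_f: f != 0.
  apply: contraNneq (nz_e) => f0.
  have: e * e = p * f * (z * w) by rewrite -De1 /f !mulrA.
  by rewrite ee f0 mulr0 mul0r => ->.
have Bwp: B (w * p) by apply: BM.
have Cf: corner e f.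
  by split; [apply: BM | rewrite /f mulrA ez | rewrite /f -!mulrA pe].
have Df := corner_idem Cf ff nz_f.
have zX j : z ^+ j.+1 * (w * p) ^+ j.+1 = e.
  elim: j => [|j IHj]; first exact: Df.
  rewrite exprSr [(w * p) ^+ j.+2]exprS mulrA -[_ * z * _]mulrA -/f Df.
  by rewrite exprSr -(mulrA _ z) ze -exprSr.
by case/eqP: (nz_e); rewrite -(zX n) zn0 mul0r.
Qed.

(** Cutting [Bsimple] down by [e] shows that [z] generates the corner as an ideal, so [z] is not
    nilpotent and some power of it is [e]. *)
Lemma corner_inverse z : corner e z -> z != 0 ->
  exists2 y, corner e y & z * y = e /\ y * z = e.
Proof.
move=> Cz nz_z; have [Bz ez ze] := Cz.
have [n [zn0|zne]] := corner_pow Cz.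
  have [l Bl Dl] := Bsimple Bz nz_z.
  case: (nilpotent_ideal_proper (l := [seq (e * p.1 * e, e * p.2 * e) | p <- l]) Cz zn0).
    move=> p /mapP[[a b] /Bl/=[Ba Bb] ->] /=.
    by split; apply: corner_mid.
  have De: e = e * (\sum_(p <- l) p.1 * z * p.2) * e by rewrite Dl mulr1 ee.
  rewrite big_map /= [RHS]De mulr_sumr mulr_suml.
  apply: eq_bigr => -[a b] _ /=.
  by rewrite -[in RHS]ez -[in RHS]ze !mulrA.
(* The outer factors matter when [n] is [0], since [1] need not lie in the corner. *)
exists (e * z ^+ n * e); first by apply: corner_mid; apply: BX.
by rewrite !mulrA ze -!mulrA ez -exprSr !mulrA -exprS zne ee.
Qed.

(** The corner is a finite division ring, hence commutative. Writing [1] as the sum of the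
    [p.1 * e * p.2], the sum of the [p.1 * z * p.2] is then central in [B], so scalar, and
    multiplying it by [e] gives back [z]. *)
Lemma corner_scalar x : B x -> exists a : k, e * x * e = a *: e.
Proof.
move=> Bx; have:= corner_mid Bx; move: (e * x * e) => {x Bx} z Cz.
have [Bz ez ze] := Cz.
have comm y1 y2: corner e y1 -> corner e y2 -> y1 * y2 = y2 * y1.
  pose C := [pred y : M | `[<corner e y>]].
  move=> C1 C2; apply: (@finite_corner_commutative M C e) => //; rewrite ?inE.
  - by apply/asboolP; split.
  - move=> u v; rewrite !inE => /asboolP[Bu eu ue] /asboolP[Bv ev ve].
    by apply/asboolP; split; rewrite ?mulrBr ?mulrBl ?eu ?ue ?ev ?ve //; apply: BB.
  - by move=> u v; rewrite !inE => /asboolP Cu /asboolP Cv; apply/asboolP/cornerM.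
  - by move=> u; rewrite inE => /asboolP[].
  - by move=> u; rewrite inE => /asboolP[].
  - move=> u; rewrite inE => /asboolP Cu /(corner_inverse Cu)[y Cy uy].
    by exists y; rewrite // inE; apply/asboolP.
  - exact/asboolP.
  exact/asboolP.
have [l Bl Dl] := Bsimple Be nz_e.
pose z' := \sum_(p <- l) p.1 * z * p.2.
have Bz': B z'.
  rewrite /z' big_seq; elim/big_ind: _ => // p /Bl[Bp1 Bp2].
  by apply: BM => //; apply: BM.
have zc y : B y -> z' * y = y * z'.
  move=> By; pose T := \sum_(p <- l) \sum_(q <- l) p.1 * z * p.2 * y * q.1 * e * q.2.
  transitivity T.
    rewrite -[LHS]mulr1 -Dl /z' 2!mulr_suml; apply: eq_bigr => p _.
    by rewrite mulr_sumr; apply: eq_bigr => q _; rewrite !mulrA.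
  rewrite -[RHS]mul1r -Dl /z' mulr_suml; apply: eq_big_seq => p /Bl[Bp1 Bp2].
  rewrite 2!mulr_sumr; apply: eq_big_seq => q /Bl[Bq1 Bq2].
  have Cpq: corner e (e * (p.2 * y * q.1) * e).
    by apply: corner_mid; apply: BM => //; apply: BM.
  have := comm _ _ Cz Cpq; rewrite !mulrA ze -[_ * e * z]mulrA ez => Dz.
  transitivity (p.1 * (z * p.2 * y * q.1 * e) * q.2); first by rewrite !mulrA.
  by rewrite Dz !mulrA.
have [a Da] := Bcenter Bz' zc; exists a.
have <-: z' * e = a *: e by rewrite Da -scalerAl mul1r.
rewrite -[e in RHS]ee mulrA zc // /z' mulr_sumr mulr_suml.
rewrite [LHS](_ : z = e * (\sum_(p <- l) p.1 * e * p.2) * e * z); last first.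
  by rewrite Dl mulr1 ee ez.
rewrite mulr_sumr !mulr_suml; apply: eq_big_seq => p /Bl[Bp1 Bp2].
have := comm _ _ Cz (corner_mid Bp2); rewrite !mulrA ze => Dz.
transitivity (e * p.1 * (e * p.2 * e * z)); first by rewrite !mulrA.
by rewrite -Dz !mulrA.
Qed.
End Corner.

Lemma simple_link e u : B e -> B u -> e != 0 -> u != 0 ->
  exists2 r, B r & e * r * u != 0.
Proof.
move=> Be Bu nz_e nz_u; have [l Bl Dl] := Bsimple Bu nz_u.
apply: contrapT => no_r; case/eqP: nz_e.
rewrite -[e]mulr1 -Dl mulr_sumr big_seq big1 // => p /Bl[Bp1 Bp2].
rewrite !mulrA; have [->|nz] := eqVneq (e * p.1 * u) 0; first exact: mul0r.
by case: no_r; exists p.1.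
Qed.

(* [phi] is a covector taking the value [1] on [v]; then [v * phi] is again a
   minimal idempotent, and it fixes [v]. *)
Lemma minimal_idempotent_fix e v : minimal_idempotent e ->
    B v -> v * e = v -> v != 0 ->
  exists2 e', minimal_idempotent e' & e' * v = v.
Proof.
move=> mi_e Bv ve nz_v; have [Be ee nz_e min_e] := mi_e.
have [r Br nz_erv] := simple_link Be Bv nz_e nz_v.
have Cerv: corner e (e * r * v).
  by split; [apply/BM => //; apply: BM | rewrite !mulrA ee | rewrite -mulrA ve].
have [y [By ey ye] [_ Dy]] := corner_inverse mi_e Cerv nz_erv.
pose phi := y * r.
have phiv: phi * v = e by rewrite /phi -[y]ye -!mulrA [e * _]mulrA.
have ephi: e * phi = phi by rewrite /phi mulrA ey.
have Bphi: B phi by apply: BM.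
clearbody phi; exists (v * phi); last by rewrite -mulrA phiv ve.
split; first exact: BM.
- by rewrite mulrA -(mulrA v) phiv ve.
- apply: contraNneq nz_v => vphi0.
  by rewrite -ve -phiv mulrA vphi0 mul0r.
move=> f Bf ff nz_f ef fe.
have Df: v * (phi * f * v) * phi = f by rewrite !mulrA ef -mulrA fe.
suff De: phi * f * v = e by rewrite -Df De ve.
apply: min_e.
- by apply: BM => //; apply: BM.
- transitivity (phi * (f * (v * phi) * f) * v); first by rewrite !mulrA.
  by rewrite fe ff.
- by apply: contraNneq nz_f => f0; rewrite -Df f0 mulr0 mul0r.
- by rewrite !mulrA ephi.
by rewrite -mulrA ve.
Qed.

(** Otherwise [g] multiplies every minimal idempotent by a scalar. By [minimal_idempotent_fix], all
    nonzero elements of [B e] are then eigenvectors of left multiplication by [g]; so [g] acts by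
    one scalar on [B e], hence on [B e B], which contains [1]. *)
Lemma nonscalar_moves_idempotent g : B g -> (forall a : k, g <> a *: 1) ->
  exists2 e, minimal_idempotent e & g * e != e * g * e.
Proof.
move=> Bg nsc; have [e mi_e] := minimal_idempotent_exists.
have [Be ee nz_e _] := mi_e; apply: contrapT => no_e.
have eig v : B v -> v * e = v -> v != 0 -> exists a : k, g * v = a *: v.
  move=> Bv ve nz_v; have [e' mi_e' e'v] := minimal_idempotent_fix mi_e Bv ve nz_v.
  have [a Da] := corner_scalar mi_e' Bg; exists a.
  have ge': g * e' = a *: e'.
    by rewrite -Da; apply: contrapT => /eqP nge; apply: no_e; exists e'.
  by rewrite -{1}e'v mulrA ge' -scalerAl e'v.
have [a Da] := eig e Be ee nz_e.
have all_eig b : B b -> g * (b * e) = a *: (b * e).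
  move=> Bb; pose v := b * e; have Bv: B v by apply: BM.
  have ve: v * e = v by rewrite -mulrA ee.
  rewrite -/v; clearbody v.
  have [-> | nz_v] := eqVneq v 0; first by rewrite mulr0 scaler0.
  have [[t ->]|not_t] := pselect (exists t : k, v = t *: e).
    by rewrite -scalerAr Da scalerA mulrC -scalerA.
  (* As [e] and [v] are not proportional, the eigenvalues of [e], [v] and [e + v] must coincide. *)
  have [av Dv] := eig v Bv ve nz_v.
  have nz_w: e + v != 0.
    apply/eqP => /eqP; rewrite addrC addr_eq0 => /eqP Dve; apply: not_t.
    by exists (- 1); rewrite scaleN1r.
  have [|aw] := eig (e + v) (BD Be Bv) _ nz_w; first by rewrite mulrDl ee ve.
  rewrite mulrDr Da Dv scalerDr => Dw.
  have Daw: (a - aw) *: e = (aw - av) *: v.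
    by apply/eqP; rewrite !scalerBl subr_eq addrAC eq_sym subr_eq Dw addrC.
  have [Dav|nz_a] := eqVneq aw av; last first.
    case: not_t; exists ((aw - av)^-1 * (a - aw)).
    by rewrite -scalerA Daw scalerA mulVf ?scale1r // subr_eq0.
  move/eqP: Daw; rewrite Dav subrr scale0r scaler_eq0 (negPf nz_e) orbF subr_eq0.
  by move/eqP=> ->.
apply: (nsc a); have [l Bl Dl] := Bsimple Be nz_e.
rewrite -[g]mulr1 -Dl mulr_sumr scaler_sumr; apply: eq_big_seq => p /Bl[Bp1 _].
by rewrite mulrA all_eig // -scalerAl.
Qed.

(** Take [n = e r (1 - e)]. Then [n g e] lies in [e B e] and is a multiple of [e], so
    [n g n = n g e n] is the same multiple of [n], nonzero as soon as [e r] does not kill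
    [(1 - e) g e]. Likewise for [g']. *)
Lemma rank_one_nilpotent g g' : B g -> B g' -> g * g' = 1 -> g' * g = 1 ->
    (forall a : k, g <> a *: 1) ->
  exists e n, [/\ B e, e * e = e, e != 0 &
     forall x, B x -> exists a : k, e * x * e = a *: e] /\
   [/\ B n, n != 0, e * n = n, n * e = 0 & exists t t' : k,
     [/\ t != 0, t' != 0, n * g * n = t *: n & n * g' * n = t' *: n]].
Proof.
move=> Bg Bg' gg' g'g nsc.
have [e mi_e nge] := nonscalar_moves_idempotent Bg nsc.
have [Be ee nz_e _] := mi_e.
have scal x : B x -> exists a : k, e * x * e = a *: e by apply: corner_scalar.
pose u := g * e - e * g * e; pose u' := g' * e - e * g' * e.
have Bu: B u by apply: BB; apply: BM => //; apply: BM.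
have Bu': B u' by apply: BB; apply: BM => //; apply: BM.
have nz_u: u != 0 by rewrite subr_eq0.
(* If [g' e] were a multiple of [e], inverting would make [g e] one too, against the choice of
   [e]. *)
have nz_u': u' != 0.
  apply: contraNneq nge => /eqP; rewrite subr_eq0 => /eqP g'e.
  have [a Da] := scal _ Bg'; rewrite Da in g'e.
  have De: e = a *: (g * e) by rewrite scalerAr -g'e mulrA gg' mul1r.
  have nz_a: a != 0 by apply: contraNneq nz_e => a0; rewrite De a0 scale0r.
  have ->: g * e = a^-1 *: e by rewrite [in RHS]De scalerA mulVf // scale1r.
  rewrite -mulrA; have ->: g * e = a^-1 *: e by rewrite [in RHS]De scalerA mulVf // scale1r.
  by rewrite -scalerAr ee.
(* The [r] that fail for [u] and those that fail for [u'] form two proper additive subgroups, whose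
   union is not all of [B]. *)
have [r Br [nz_r nz_r']]: exists2 r, B r & e * r * u != 0 /\ e * r * u' != 0.
  have [r1 Br1 nz1] := simple_link Be Bu nz_e nz_u.
  have [r2 Br2 nz2] := simple_link Be Bu' nz_e nz_u'.
  have [z1|] := eqVneq (e * r1 * u') 0; last by exists r1.
  have [z2|] := eqVneq (e * r2 * u) 0; last by exists r2.
  exists (r1 + r2); first exact: BD.
  by rewrite (mulrDr e) !(mulrDl (e * r1)) z1 z2 addr0 add0r.
pose n := e * r - e * r * e.
have Bn: B n by apply: BB; [apply: BM | apply: BM => //; apply: BM].
have en: e * n = n by rewrite mulrBr !mulrA ee.
have ne: n * e = 0 by rewrite mulrBl -!mulrA ee subrr.
have key h : e * r * (h * e - e * h * e) = n * h * e.
  by rewrite /n mulrBr !mulrBl !mulrA.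
have kill h (s : k) : n * h * e = s *: e -> n * h * n = s *: n.
  by move=> Dh; rewrite -{2}en mulrA Dh -scalerAl en.
have val h : B h -> e * r * (h * e - e * h * e) != 0 -> exists2 s : k, s != 0 &
    n * h * n = s *: n.
  move=> Bh; rewrite key => nz; have Bnh: B (n * h) by apply: BM.
  have [s Ds] := scal _ Bnh; rewrite !mulrA en in Ds.
  exists s; last exact: kill.
  by apply: contraNneq nz => s0; rewrite Ds s0 scale0r.
have [t nz_t Dt] := val _ Bg nz_r; have [t' nz_t' Dt'] := val _ Bg' nz_r'.
exists e, n; split; split=> //; last by exists t, t'.
by apply: contraNneq nz_r => n0; rewrite key n0 !mul0r.
Qed.

End FiniteSimple.

(** * Central simple algebras *)

Section CentralAlgebra.
Variables (F : fieldType) (A : nzRingType) (iota : {rmorphism F -> A}).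
Hypothesis iotaC : forall c x, iota c * x = x * iota c.

Definition lincomb m (b : 'I_m -> A) (c : 'rV[F]_m) := \sum_i iota (c 0 i) * b i.

Lemma lincombD m (b : 'I_m -> A) c d :
  lincomb b (c + d) = lincomb b c + lincomb b d.
Proof.
rewrite /lincomb -big_split; apply: eq_bigr => i _ /=.
by rewrite mxE rmorphD mulrDl.
Qed.

Lemma lincombZ m (b : 'I_m -> A) a c : lincomb b (a *: c) = iota a * lincomb b c.
Proof.
rewrite /lincomb mulr_sumr; apply: eq_bigr => i _ /=.
by rewrite mxE rmorphM mulrA.
Qed.

Lemma lincomb_delta m (b : 'I_m -> A) j : lincomb b (delta_mx 0 j) = b j.
Proof.
rewrite /lincomb (bigD1 j) //= big1 ?addr0 ?mxE ?eqxx ?rmorph1 ?mul1r // => i ne.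
by rewrite mxE eqxx (negPf ne) rmorph0 mul0r.
Qed.

(** A spanning family of least length is independent, since a vector with a nonzero coefficient in a
    relation could be dropped. Its length is a successor because [1] is nonzero. *)
Lemma basis_exists (I : finType) (s : I -> A) :
  (forall x, exists c : I -> F, x = \sum_i iota (c i) * s i) ->
  exists m (b : 'I_m.+1 -> A) (co : A -> 'rV[F]_m.+1),
    cancel co (lincomb b) /\ cancel (lincomb b) co.
Proof.
move=> spans.
pose P (u : {m & 'I_m -> A}) := forall x, exists c, x = lincomb (tagged u) c.
have P0: P (Tagged (fun m => 'I_m -> A) (fun i : 'I_#|I| => s (enum_val i))).
  move=> x; have [c Dx] := spans x; exists (\row_i c (enum_val i)); rewrite Dx.
  rewrite (reindex (@enum_val I predT)); last exact: onW_bij (@enum_val_bij I).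
  by apply: eq_bigr => i _; rewrite mxE.
have [[m b] /= span_b min_b] := ex_minimal (fun u => tag u) P0.
case: m b span_b min_b => [|m] b span_b min_b.
  have [c D1] := span_b 1; case/eqP: (oner_neq0 A).
  by rewrite D1 /lincomb big_ord0.
have [co Dco] := choice span_b; exists m, b, co; split=> [x|c]; first by rewrite -Dco.
apply/eqP; rewrite -subr_eq0; apply: contrapT => nz_d.
set d := _ - _ in nz_d.
have d0: lincomb b d = 0.
  by rewrite lincombD -Dco -scaleN1r lincombZ rmorphN1 mulN1r subrr.
have{nz_d} /rV0Pn[j nz_dj] : d != 0 by apply/negP.
clearbody d.
suffices /min_b: P (Tagged (fun m => 'I_m -> A) (fun i => b (lift j i))).
  by rewrite ltnn.
move=> x; have [cx Dx] := span_b x.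
pose c' := cx - (cx 0 j / d 0 j) *: d.
have c'j: c' 0 j = 0 by rewrite !mxE divfK // subrr.
exists (\row_i c' 0 (lift j i)).
have ->: x = lincomb b c'.
  by rewrite lincombD -scaleNr lincombZ d0 mulr0 addr0.
rewrite /lincomb (bigD1_ord j) //= c'j rmorph0 mul0r add0r.
by apply: eq_bigr => i _; rewrite mxE.
Qed.

Hypothesis A_simple : forall z : A, z != 0 ->
  exists l : seq (A * A), \sum_(p <- l) p.1 * z * p.2 = 1.
Hypothesis A_center : forall z : A, (forall x, z * x = x * z) ->
  exists c, z = iota c.

(** The action on [A] of its tensor product with the opposite ring. Keeping the list of pairs allows
    asking later that its finitely many entries be integral at a place. *)
Definition mulop (l : seq (A * A)) (x : A) := \sum_(p <- l) p.1 * x * p.2.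
Definition is_mulop (f : A -> A) := exists l, f =1 mulop l.

Lemma is_mulop_id : is_mulop id.
Proof. by exists [:: (1, 1)] => x; rewrite /mulop big_seq1 mul1r mulr1. Qed.

Lemma is_mulop_add f g : is_mulop f -> is_mulop g -> is_mulop (fun x => f x + g x).
Proof. by move=> [l Df] [l' Dg]; exists (l ++ l') => x; rewrite Df Dg /mulop big_cat. Qed.

Lemma is_mulop_mul f a b : is_mulop f -> is_mulop (fun x => a * f x * b).
Proof.
move=> [l Df]; exists [seq (a * p.1, p.2 * b) | p <- l] => x.
rewrite Df /mulop big_map mulr_sumr mulr_suml; apply: eq_bigr => p _ /=.
by rewrite !mulrA.
Qed.

Lemma is_mulop_mulr f b : is_mulop f -> is_mulop (fun x => f x * b).
Proof. by move=> /(is_mulop_mul 1 b)[l Dl]; exists l => x; rewrite -Dl mul1r. Qed.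

Lemma is_mulop_mull f a : is_mulop f -> is_mulop (fun x => a * f x).
Proof. by move=> /(is_mulop_mul a 1)[l Dl]; exists l => x; rewrite -Dl mulr1. Qed.

Lemma is_mulop_sub f g : is_mulop f -> is_mulop g -> is_mulop (fun x => f x - g x).
Proof.
move=> opf /(is_mulop_mull (-1)) opg; have [l Dl] := is_mulop_add opf opg.
by exists l => x; rewrite -Dl mulN1r.
Qed.

Lemma is_mulop_sum (I : Type) (r : seq I) (P : pred I) (f : I -> A -> A) :
  (forall i, P i -> is_mulop (f i)) -> is_mulop (fun x => \sum_(i <- r | P i) f i x).
Proof.
move=> opf; elim: r => [|i r [l Dl]].
  by exists [::] => x; rewrite /mulop !big_nil.
have [Pi|nPi] := boolP (P i); last first.
  by exists l => x; rewrite big_cons (negPf nPi).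
have [l' Dl'] := is_mulop_add (opf i Pi) (ex_intro _ l Dl).
by exists l' => x; rewrite -Dl' big_cons Pi.
Qed.

Lemma is_mulop_comp f g : is_mulop f -> is_mulop g -> is_mulop (f \o g).
Proof.
move=> [l Df] opg.
have [l' Dl'] : is_mulop (fun x => \sum_(p <- l) p.1 * g x * p.2).
  by apply: is_mulop_sum => p _; apply: is_mulop_mul.
by exists l' => x; rewrite /= Df -Dl'.
Qed.

Variables (m : nat) (b : 'I_m.+1 -> A) (co : A -> 'rV[F]_m.+1).
Hypotheses (coK : cancel co (lincomb b)) (lincombK : cancel (lincomb b) co).

Lemma co_inj : injective co. Proof. exact: can_inj coK. Qed.

Lemma coD x y : co (x + y) = co x + co y.
Proof. by rewrite -[in LHS](coK x) -[in LHS](coK y) -lincombD lincombK. Qed.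

Lemma coZ c x : co (iota c * x) = c *: co x.
Proof. by rewrite -[in LHS](coK x) -lincombZ lincombK. Qed.

Lemma co_basis i : co (b i) = delta_mx 0 i.
Proof. by rewrite -lincomb_delta lincombK. Qed.

Lemma coB x y : co (x - y) = co x - co y.
Proof. by rewrite -[- y]mulN1r -(rmorphN1 iota) coD coZ scaleN1r. Qed.

Lemma co0 : co 0 = 0. Proof. by rewrite -(subrr 0) coB subrr. Qed.

Lemma co_sum (I : Type) (r : seq I) (f : I -> A) :
  co (\sum_(i <- r) f i) = \sum_(i <- r) co (f i).
Proof. by elim: r => [|i r IHr]; rewrite ?big_nil ?co0 // !big_cons coD IHr. Qed.

Lemma mulop_lin f : is_mulop f -> forall x,
  f x = \sum_i iota (co x 0 i) * f (b i).
Proof.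
move=> [l Df] x; rewrite Df -{1}(coK x) /mulop.
under [RHS]eq_bigr do rewrite Df mulr_sumr.
rewrite exchange_big; apply: eq_bigr => p _ /=.
rewrite mulr_sumr mulr_suml; apply: eq_bigr => i _.
by rewrite !mulrA iotaC.
Qed.

(* Artin's argument for the density of the multiplication operators, by
   induction on the number of basis vectors already dealt with. *)
Lemma dual_mulops q : (q <= m.+1)%N -> exists phi : 'I_m.+1 -> A -> A,
  forall i : 'I_m.+1, (i < q)%N -> is_mulop (phi i) /\
    forall j : 'I_m.+1, (j < q)%N -> phi i (b j) = (i == j)%:R.
Proof.
elim: q => [|q IHq] lt_q; first by exists (fun _ => id).
have [phi phiP] := IHq (ltnW lt_q); pose iq := Ordinal lt_q.
have [psi [op_psi psi0 nz_psi]] : exists psi, [/\ is_mulop psi,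
    forall j : 'I_m.+1, (j < q)%N -> psi (b j) = 0 & psi (b iq) != 0].
  (* If some [phi i (b iq)] is not central, a commutator of [phi i] with some [c] works, because
     [phi i] takes the central values [0] and [1] on the earlier basis vectors. If all are scalars,
     projecting away from the earlier vectors works, by independence. *)
  have [[i [lt_iq [c nc]]]|allc] := pselect (exists i : 'I_m.+1, (i < q)%N /\
      exists c, c * phi i (b iq) <> phi i (b iq) * c).
    have [opi di] := phiP i lt_iq.
    exists (fun x => c * phi i x - phi i x * c); split.
    - by apply: is_mulop_sub; [apply: is_mulop_mull | apply: is_mulop_mulr].
    - by move=> j /di->; case: eqP; rewrite ?mulr1 ?mul1r ?mulr0 ?mul0r subrr.
    by rewrite subr_eq0; apply/eqP.
  have /choice[c Dc] (i : 'I_m.+1) :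
      exists c, (i < q)%N -> phi i (b iq) = iota c.
    have [lt_iq|_] := ltnP i q; last by exists 0.
    have [x|c Dc] := @A_center (phi i (b iq)); last by exists c.
    by apply: contrapT => nx; apply: allc; exists i; split=> //; exists x => /esym.
  exists (fun x => x - \sum_(i < m.+1 | (i < q)%N) phi i x * b i); split.
  - apply: is_mulop_sub; first exact: is_mulop_id.
    by apply: is_mulop_sum => i /phiP[opi _]; apply: is_mulop_mulr.
  - move=> j lt_jq; rewrite (bigD1 j) //= (phiP j lt_jq).2 // eqxx mul1r big1.
      by rewrite addr0 subrr.
    by move=> i /andP[/phiP[_ ->//] /negPf->]; rewrite mul0r.
  apply: contraTneq (oner_neq0 F) => psi0.
  have: co (b iq) 0 iq = 1 by rewrite co_basis mxE !eqxx.
  move/eqP: psi0; rewrite subr_eq0 => /eqP->.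
  rewrite (_ : \sum_(i < _ | _) _ = lincomb b (\row_i if (i < q)%N then c i else 0)).
    by rewrite lincombK mxE ltnn => <-; rewrite eqxx.
  rewrite big_mkcond; apply: eq_bigr => i _; rewrite mxE.
  by case: ifP => [/Dc->//|_]; rewrite rmorph0 mul0r.
(* Simplicity turns the value at [b iq] into [1]; the earlier operators are then corrected by
   multiples of [psi']. *)
have [l Dl] := A_simple nz_psi.
pose psi' x := mulop l (psi x).
have op_psi': is_mulop psi' by apply: (is_mulop_comp _ op_psi); exists l.
have psi'q: psi' (b iq) = 1 by [].
have psi'0 (j : 'I_m.+1) : (j < q)%N -> psi' (b j) = 0.
  move=> lt_j; rewrite /psi' psi0 // /mulop big1 // => p _.
  by rewrite mulr0 mul0r.
have ltqP (j : 'I_m.+1) : (j < q.+1)%N -> j = iq \/ (j < q)%N /\ (iq == j) = false.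
  rewrite ltnS leq_eqVlt => /orP[/eqP ej|lt_j]; first by left; apply: val_inj.
  by right; split=> //; apply/eqP => ej; rewrite -ej ltnn in lt_j.
exists (fun i x => if i == iq then psi' x else phi i x - phi i (b iq) * psi' x).
move=> i /ltqP[->|[lt_iq ne_i]].
  rewrite eqxx; split=> // j /ltqP[->|[lt_jq ->]]; first by rewrite eqxx.
  exact: psi'0.
have [opi di] := phiP i lt_iq; rewrite eq_sym ne_i; split.
  by apply: is_mulop_sub => //; apply: is_mulop_mull.
move=> j /ltqP[->|[lt_jq _]]; first by rewrite psi'q mulr1 subrr eq_sym ne_i.
by rewrite psi'0 // mulr0 subr0 di.
Qed.

(** Coordinates obtained by multiplications can still be computed after reduction, which is how
    simplicity and the center are controlled there. *)
Lemma coord_mulop i : exists l, forall x, mulop l x = iota (co x 0 i).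
Proof.
have [phi /(_ i (ltn_ord i))[opi di]] := dual_mulops (leqnn m.+1).
have [l Dl] := opi; exists l => x; rewrite -Dl (mulop_lin opi) (bigD1 i) //=.
rewrite di // eqxx mulr1 big1 ?addr0 // => j ne_ji.
by rewrite di // eq_sym (negPf ne_ji) mulr0.
Qed.

(** Right multiplication acting on row vectors of coordinates, so that the order of products is
    preserved. *)
Definition regrep (x : A) : 'M[F]_m.+1 := \matrix_i co (b i * x).

Lemma co_regrep y x : co (y * x) = co y *m regrep x.
Proof.
rewrite -[in LHS](coK y) /lincomb mulr_suml co_sum mulmx_sum_row.
by apply: eq_bigr => i _; rewrite rowK -mulrA coZ.
Qed.

Lemma regrepM x y : regrep (x * y) = regrep x *m regrep y.
Proof. by apply/row_matrixP => i; rewrite row_mul !rowK mulrA co_regrep. Qed.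

Lemma regrepB x y : regrep (x - y) = regrep x - regrep y.
Proof. by apply/row_matrixP => i; rewrite linearB /= !rowK mulrBr coB. Qed.

Lemma regrepD x y : regrep (x + y) = regrep x + regrep y.
Proof. by apply/row_matrixP => i; rewrite linearD /= !rowK mulrDr coD. Qed.

Lemma regrep_scalar c : regrep (iota c) = c%:M.
Proof.
by apply/row_matrixP => i; rewrite rowK -iotaC coZ co_basis rowE mul_mx_scalar.
Qed.

Lemma regrepZ c x : regrep (iota c * x) = c *: regrep x.
Proof. by rewrite regrepM regrep_scalar mul_scalar_mx. Qed.

Lemma regrep1 : regrep 1 = 1%:M.
Proof. by rewrite -(rmorph1 iota) regrep_scalar. Qed.

Lemma regrep_inj : injective regrep.
Proof. by move=> x y Dxy; apply: co_inj; rewrite -[x]mul1r -[y]mul1r !co_regrep Dxy. Qed.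

Lemma regrep_unit x : regrep x \in unitmx -> exists y, x * y = 1 /\ y * x = 1.
Proof.
move=> Ux; pose y := lincomb b (co 1 *m invmx (regrep x)).
have yx: y * x = 1 by apply: co_inj; rewrite co_regrep lincombK mulmxKV.
exists y; split=> //; apply: regrep_inj; rewrite regrepM regrep1.
apply: mulmx1C; by rewrite -regrepM yx regrep1.
Qed.

End CentralAlgebra.

(** * Reduction of a central simple algebra *)

Section Reduction.
Variables (F : fieldType) (A : nzRingType) (iota : {rmorphism F -> A}).
Hypothesis iotaC : forall c x, iota c * x = x * iota c.
Variables (m : nat) (b : 'I_m.+1 -> A) (co : A -> 'rV[F]_m.+1).
Hypotheses (coK : cancel co (lincomb iota b)) (lincombK : cancel (lincomb iota b) co).
Local Notation rho := (regrep b co).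
Let rhoM := regrepM coK lincombK.
Let rhoB := regrepB coK lincombK.
Let rho_scalar := regrep_scalar iotaC coK lincombK.

Section AtPlace.
Variable P : place F.
Local Notation k := (pres P).

Definition integral x := exists Y, @mxspec F P _ _ (rho x) Y.

(** The value [0] is a default for elements that are not integral; the rules of computation
    establish integrality together with the value. *)
Definition red (x : A) : 'M[k]_m.+1 :=
  if pselect (integral x) is left ix then sval (cid ix) else 0.

Lemma redP x : integral x -> mxspec (rho x) (red x).
Proof. by rewrite /red; case: pselect => // ix _; apply: svalP. Qed.

Lemma red_eq x Y : mxspec (rho x) Y -> integral x /\ red x = Y.
Proof.
move=> sY; have ix: integral x by exists Y.
by split=> //; apply: mxspec_inj (redP ix) sY.
Qed.

Lemma redM x y : integral x -> integral y ->
  integral (x * y) /\ red (x * y) = red x * red y.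
Proof.
move=> /redP sx /redP sy; apply: red_eq; rewrite rhoM; exact: mxspecM.
Qed.

Lemma redB x y : integral x -> integral y ->
  integral (x - y) /\ red (x - y) = red x - red y.
Proof. by move=> /redP sx /redP sy; apply: red_eq; rewrite rhoB; apply: mxspecB. Qed.

Lemma red_scalar c a : specializes c a ->
  integral (iota c) /\ red (iota c) = (a : k) *: 1.
Proof.
have <-: a%:M = a *: 1 :> 'M[k]_m.+1 by rewrite -scalemx1.
move=> sa; apply: red_eq; rewrite rho_scalar.
exact: mxspec_scalar.
Qed.

Lemma red1 : integral 1 /\ red 1 = 1.
Proof.
have := red_scalar (specializes1 P); by rewrite rmorph1 scale1r.
Qed.

Lemma red0 : integral 0 /\ red 0 = 0.
Proof. by have [i1 _] := red1; have := redB i1 i1; rewrite !subrr. Qed.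

Lemma redD x y : integral x -> integral y ->
  integral (x + y) /\ red (x + y) = red x + red y.
Proof.
move=> ix iy; have [i0 r0] := red0; have [iN rN] := redB i0 iy.
have := redB ix iN; by rewrite rN r0 !sub0r !opprK.
Qed.

Lemma redX x n : integral x -> integral (x ^+ n) /\ red (x ^+ n) = red x ^+ n.
Proof.
move=> ix; elim: n => [|n [iX rX]]; first exact: red1.
by rewrite !exprS -rX; apply: redM.
Qed.

Lemma red_sum (I : eqType) (r : seq I) (f : I -> A) :
    (forall i, i \in r -> integral (f i)) ->
  integral (\sum_(i <- r) f i) /\ red (\sum_(i <- r) f i) = \sum_(i <- r) red (f i).
Proof.
elim: r => [|i r IHr] int_f; first by rewrite !big_nil; apply: red0.
have [|iS rS] := IHr; first by move=> j rj; apply: int_f; rewrite inE rj orbT.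
by rewrite !big_cons -rS; apply: redD => //; apply: int_f; rewrite mem_head.
Qed.

Lemma red_mulop l x : (forall p, p \in l -> integral p.1 /\ integral p.2) ->
    integral x ->
  integral (mulop l x) /\
    red (mulop l x) = \sum_(p <- l) red p.1 * red x * red p.2.
Proof.
move=> il ix; have redp p : p \in l -> integral (p.1 * x * p.2) /\
    red (p.1 * x * p.2) = red p.1 * red x * red p.2.
  move=> /il[i1 i2]; have [ix1 <-] := redM i1 ix; exact: redM.
have [|iS rS] := @red_sum _ l (fun p => p.1 * x * p.2).
  by move=> p /redp[].
by split=> //; rewrite rS; apply: eq_big_seq => p /redp[_].
Qed.

Hypothesis int_b : forall i, integral (b i).
Variable v1 : 'rV[k]_m.+1.
Hypothesis spec_co1 : mxspec (co 1) v1.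

(** Since [co x = co 1 *m rho x], integrality of the regular representation gives that of the
    coordinates once [co 1] is integral. *)
Lemma red_coord x : integral x -> exists2 v : 'rV[k]_m.+1,
  (forall i, specializes (co x 0 i) (v 0 i)) & red x = \sum_i v 0 i *: red (b i).
Proof.
move=> ix; have Dx: co x = co 1 *m rho x.
  by rewrite -(co_regrep coK lincombK) mul1r.
have sv i: specializes (co x 0 i) ((v1 *m red x) 0 i).
  by apply: (iffLR (mxspecP _ _)); rewrite Dx; apply: mxspecM (redP ix).
exists (v1 *m red x) => //; set v := _ *m _ in sv *.
have redi i : integral (iota (co x 0 i) * b i) /\
    red (iota (co x 0 i) * b i) = v 0 i *: red (b i).
  have [ic rc] := red_scalar (sv i); have [ib ->] := redM ic (int_b i).
  by rewrite rc -scalerAl mul1r.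
have [|_ rS] := @red_sum _ (index_enum _) (fun i => iota (co x 0 i) * b i).
  by move=> i _; case: (redi i).
rewrite -[x in LHS]coK [LHS]rS; apply: eq_bigr => i _.
by case: (redi i).
Qed.

Definition residue (Y : 'M[k]_m.+1) := exists2 x, integral x & red x = Y.

Lemma residue1 : residue 1. Proof. by exists 1; case: red1. Qed.

Lemma residueB X Y : residue X -> residue Y -> residue (X - Y).
Proof. by move=> [x ix <-] [y iy <-]; exists (x - y); case: (redB ix iy). Qed.

Lemma residueM X Y : residue X -> residue Y -> residue (X * Y).
Proof. by move=> [x ix <-] [y iy <-]; exists (x * y); case: (redM ix iy). Qed.

Variable dual : 'I_m.+1 -> seq (A * A).
Hypothesis dualP : forall i x, mulop (dual i) x = iota (co x 0 i).
Hypothesis int_dual :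
  forall i p, p \in dual i -> integral p.1 /\ integral p.2.

Lemma red_dual x i c : integral x -> specializes (co x 0 i) c ->
  \sum_(p <- dual i) red p.1 * red x * red p.2 = (c : k) *: 1.
Proof.
move=> ix sc; have [_ <-] := red_mulop (@int_dual i) ix.
by rewrite dualP; case: (red_scalar sc).
Qed.

(** A nonzero reduction has a nonzero coordinate, which the reduced operator [dual i] extracts.
    Division by it uses one of its powers, which lifts to [A] and so stays among the residues. *)
Lemma residue_simple Y : residue Y -> Y != 0 ->
  exists2 l : seq ('M[k]_m.+1 * 'M[k]_m.+1),
    (forall p, p \in l -> residue p.1 /\ residue p.2) &
    \sum_(p <- l) p.1 * Y * p.2 = 1.
Proof.
move=> [x ix <-] nz_x; have [v sv Dv] := red_coord ix.
have [i nz_vi] : exists i, v 0 i != 0.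
  apply: contrapT => v0; case/eqP: nz_x; rewrite Dv big1 // => i _.
  have [->|nz_vi] := eqVneq (v 0 i) 0; first exact: scale0r.
  by case: v0; exists i.
have [N DN] := finField_inv_exp nz_vi; have [ic rc] := red_scalar (sv i).
have [iN rN] := redX N ic; pose cN := red (iota (co x 0 i) ^+ N).
have DcN: cN = v 0 i ^+ N *: 1.
  by rewrite /cN rN rc exprZn expr1n.
exists [seq (cN * red p.1, red p.2) | p <- dual i].
  move=> p /mapP[q /int_dual[i1 i2] ->] /=; split; last by exists q.2.
  by apply: residueM; [exists (iota (co x 0 i) ^+ N) | exists q.1].
rewrite big_map -[1]scale1r -DN -scalerA -(red_dual ix (sv i)) scaler_sumr.
by apply: eq_bigr => p _ /=; rewrite DcN -!scalerAl mul1r.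
Qed.

(** A central [red x] can be pulled out of the operator [dual i]. Comparing the values at [x] and at
    [1], for an [i] where [1] has a nonzero reduced coordinate, shows [red x] to be a quotient of
    two coordinates. *)
Lemma residue_center Y : residue Y -> (forall X, residue X -> Y * X = X * Y) ->
  exists a : k, Y = a *: 1.
Proof.
move=> [x ix <-] xC; have [i1 r1] := red1.
have [v sv Dv] := red_coord i1.
have [i nz_vi] : exists i, v 0 i != 0.
  apply: contrapT => v0; case/eqP: (oner_neq0 'M[k]_m.+1); rewrite -r1 Dv big1 // => i _.
  have [->|nz_vi] := eqVneq (v 0 i) 0; first exact: scale0r.
  by case: v0; exists i.
have [w sw _] := red_coord ix; exists ((v 0 i)^-1 * w 0 i).
rewrite -scalerA -(red_dual ix (sw i)).
transitivity ((v 0 i)^-1 *: (red x * (v 0 i *: 1))).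
  by rewrite -scalerAr mulr1 scalerA mulVf // scale1r.
congr (_ *: _); rewrite -(red_dual i1 (sv i)) mulr_sumr.
apply: eq_big_seq => p /int_dual[ip1 _].
by rewrite r1 mulr1 mulrA xC //; exists p.1.
Qed.

(** A scalar reduction of [g] would make the commutator [w] reduce to [0], whereas the coordinate
    [co w 0 i], whose inverse specializes, keeps a nonzero value. *)
Lemma red_not_scalar g i j (w := g * b j - b j * g) :
    integral g -> co w 0 i != 0 -> (exists c : k, specializes (co w 0 i)^-1 c) ->
  forall a : k, red g <> a *: 1.
Proof.
move=> ig nz_w [c sc] a Dg.
have [i1 r1] := redM ig (int_b j); have [i2 r2] := redM (int_b j) ig.
have [iw rw] := redB i1 i2.
have red_w0: red w = 0.
  by rewrite /w rw r1 r2 Dg -scalerAl -scalerAr mul1r mulr1 subrr.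
have [v sv _] := red_coord iw; have := red_dual iw (sv i).
rewrite -/w red_w0 big1 => [/esym/eqP|p _]; last by rewrite mulr0 mul0r.
rewrite scaler_eq0 oner_eq0 orbF => /eqP v0.
have := specializesM sc (sv i); rewrite mulVf // v0 mulr0 => s10.
by case/eqP: (oner_neq0 k); apply: specializes_inj (specializes1 P) s10.
Qed.

End AtPlace.
End Reduction.

(** The powers of [p] are distinct and at most [m] of them are eigenvalues of [- X]. When [p]
    reduces to [0], this makes an element a unit without changing its reduction. *)
Lemma regular_shift (F : fieldType) m (X : 'M[F]_m) (p : F) :
    p != 0 -> (forall j, p ^+ j.+1 != 1) ->
  exists j, X + (p ^+ j.+1)%:M \in unitmx.
Proof.
move=> nz_p p_inf; apply: contrapT => sing.
pose s := [seq p ^+ j.+1 | j <- iota 0 m.+1].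
have inj i j : (i < j)%N -> p ^+ i.+1 != p ^+ j.+1.
  move=> lt_ij; apply: contraNneq (p_inf (j - i).-1) => Dij.
  rewrite prednK ?subn_gt0 //; apply/eqP.
  apply: (mulfI (expf_neq0 i.+1 nz_p)); rewrite mulr1 -exprD addSn.
  by rewrite (subnKC (ltnW lt_ij)).
have Us: uniq s.
  rewrite map_inj_uniq ?iota_uniq // => i j Dij; apply/eqP.
  by case: ltngtP => // /inj; rewrite Dij eqxx.
have rts: all (root (char_poly (- X))) s.
  apply/allP => _ /mapP[j _ ->]; rewrite -eigenvalue_root_char.
  apply: contrapT => /negP; rewrite negbK kermx_eq0 row_free_unit => nu.
  apply: sing; exists j.
  have -> : X + (p ^+ j.+1)%:M = -1 *: (- X - (p ^+ j.+1)%:M).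
    by rewrite scaleN1r opprB opprK addrC.
  by rewrite unitmxZ // unitrN1.
have := max_poly_roots (monic_neq0 (char_poly_monic (- X))) rts Us.
by rewrite size_map size_iota size_char_poly ltnn.
Qed.

Definition subring_gen (A : nzRingType) (S : seq A) (x : A) :=
  forall K : A -> Prop, K 1 -> (forall x y, K x -> K y -> K (x - y)) ->
    (forall x y, K x -> K y -> K (x * y)) -> (forall s, s \in S -> K s) -> K x.

(** * Units that cannot be integral together with their inverses *)

Section Core.
Variables (F : fieldType) (A : nzRingType) (iota : {rmorphism F -> A}).
Hypothesis iotaC : forall c x, iota c * x = x * iota c.
Hypothesis A_simple : forall z : A, z != 0 ->
  exists l : seq (A * A), \sum_(p <- l) p.1 * z * p.2 = 1.
Hypothesis A_center : forall z : A, (forall x, z * x = x * z) ->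
  exists c, z = iota c.
Variables (I : finType) (s0 : I -> A).
Hypothesis s0_spans :
  forall x, exists c : I -> F, x = \sum_i iota (c i) * s0 i.
Variables (S : seq A) (g g' : A).
Hypotheses (Sg : g \in S) (Sg' : g' \in S) (gg' : g * g' = 1) (g'g : g' * g = 1).
Hypothesis g_noncentral : exists x, g * x <> x * g.
Hypothesis S_infinite : ~ exists T : seq A, forall x, subring_gen S x -> x \in T.

(* [x'] stands for the inverse of [x], and [Q x x'] says that multiples of [x]
   and [x'] reduce to [n g^-1] and [g n] up to nonzero factors. *)
Theorem escaping_units : exists Q : A -> A -> Prop,
  [/\ exists x x', [/\ x * x' = 1, x' * x = 1 & Q x x'],
      forall x x', x * x' = 1 -> x' * x = 1 -> Q x x' ->
        Q (x * g * x' * g') (g * x * g' * x'),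
      forall x x' N, Q x x' -> Q (x ^+ N.+1) (x' ^+ N.+1) &
      forall x x', x' * x = 1 -> x * x' = 1 -> Q x x' ->
        subring_gen S x -> subring_gen S x' -> False].
Proof.
have [m [b [co [coK lincombK]]]] := basis_exists s0_spans.
have [dual dualP] := choice (coord_mulop iotaC A_simple A_center coK lincombK).
set rho := regrep b co.
(* Some basis vector does not commute with [g]. Making the inverse of a nonzero coordinate of the
   commutator specialize will keep the reduction of [g] from being scalar. *)
have [j [i nz_w]] : exists j i, co (g * b j - b j * g) 0 i != 0.
  apply: contrapT => w0; have [x] := g_noncentral; apply.
  rewrite -[x]coK /lincomb mulr_sumr mulr_suml; apply: eq_bigr => j _.
  rewrite mulrA -iotaC -!mulrA; congr (_ * _); apply/eqP; rewrite -subr_eq0.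
  apply/eqP/(co_inj coK); rewrite (co0 coK lincombK).
  apply/matrixP => o i; rewrite ord1 mxE; apply/eqP; apply: contrapT => /negP nz.
  by apply: w0; exists j, i.
set w := _ - _ in nz_w.
pose entries m' n' (X : 'M[F]_(m', n')) := [seq X ij.1 ij.2 | ij <- enum predT].
pose xs := [seq b i | i <- enum predT]
  ++ flatten [seq [seq p.1 | p <- dual i] ++ [seq p.2 | p <- dual i] | i <- enum predT] ++ S.
have [P Pin] := place_exists
  ((co w 0 i)^-1 :: entries _ _ (co 1) ++ flatten [seq entries _ _ (rho x) | x <- xs]).
have int_xs x : x \in xs -> integral b co P x.
  move=> xsx; apply: mxspec_total => u v; apply: Pin; rewrite inE mem_cat; apply/orP; right.
  apply/orP; right; apply/flattenP; exists (entries _ _ (rho x)); first exact: map_f.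
  by apply/mapP; exists (u, v); rewrite ?mem_enum.
have int_b l : integral b co P (b l).
  by apply: int_xs; rewrite mem_cat map_f ?mem_enum.
have int_dual l p : p \in dual l -> integral b co P p.1 /\ integral b co P p.2.
  move=> lp; split; apply: int_xs; rewrite !mem_cat; apply/orP; right; apply/orP; left;
    apply/flattenP; exists ([seq p.1 | p <- dual l] ++ [seq p.2 | p <- dual l]).
  - by apply/mapP; exists l; rewrite ?mem_enum.
  - by rewrite mem_cat map_f.
  - by apply/mapP; exists l; rewrite ?mem_enum.
  by rewrite mem_cat orbC map_f.
have int_S x : x \in S -> integral b co P x.
  by move=> Sx; apply: int_xs; rewrite !mem_cat Sx !orbT.
have [v1 spec1] : exists v1, @mxspec F P _ _ (co 1) v1.
  apply: mxspec_total => u v; apply: Pin; rewrite inE mem_cat; apply/orP; right.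
  by apply/orP; left; apply/mapP; exists (u, v); rewrite ?mem_enum.
have [cw spec_w] : exists c, @specializes F P (co w 0 i)^-1 c.
  by apply: Pin; rewrite mem_head.
pose R := red b co P; pose int := integral b co P.
have intM x y : int x -> int y -> int (x * y) /\ R (x * y) = R x * R y :=
  fun ix iy => redM coK lincombK ix iy.
have intB x y : int x -> int y -> int (x - y) /\ R (x - y) = R x - R y :=
  fun ix iy => redB coK lincombK ix iy.
have intD x y : int x -> int y -> int (x + y) /\ R (x + y) = R x + R y :=
  fun ix iy => redD iotaC coK lincombK ix iy.
have [int1 R1] : int 1 /\ R 1 = 1 := red1 iotaC coK lincombK P.
have gen_int x : subring_gen S x -> int x.
  apply; [exact: int1 | | | exact: int_S] => y z iy iz.
    by have [] := intB _ _ iy iz.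
  by have [] := intM _ _ iy iz.
have ig: int g := int_S g Sg; have ig': int g' := int_S g' Sg'.
have GG': R g * R g' = 1 by case: (intM _ _ ig ig') => _ <-; rewrite gg'.
have G'G: R g' * R g = 1 by case: (intM _ _ ig' ig) => _ <-; rewrite g'g.
have [e [n [[Be ee nz_e sc_e]]]] := rank_one_nilpotent
  (residue1 iotaC coK lincombK P) (@residueB _ _ _ _ _ _ coK lincombK P)
  (@residueM _ _ _ _ _ _ coK lincombK P)
  (@residue_simple _ _ _ iotaC _ _ _ coK lincombK P int_b v1 spec1 dual dualP int_dual)
  (@residue_center _ _ _ iotaC _ _ _ coK lincombK P int_b v1 spec1 dual dualP int_dual)
  (ex_intro2 _ _ g ig erefl) (ex_intro2 _ _ g' ig' erefl) GG' G'G
  (red_not_scalar iotaC coK lincombK int_b spec1 dualP int_dual ig nz_w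
     (ex_intro _ cw spec_w)).
move=> [Bn nz_n en ne [t [t' [nz_t nz_t' ngn ng'n]]]].
have nn: n * n = 0 by rewrite -{2}en mulrA ne mul0r.
(* Without such a [p], reduction would be injective on integral elements, and the infinite subring
   generated by [S] would embed in a finite matrix ring. *)
have [p nz_p sp] : exists2 p, p != 0 & @specializes F P p 0.
  apply: contrapT => inj; apply: S_infinite.
  pose pick Y := if pselect (exists x, int x /\ R x = Y) is left h then sval (cid h) else 0.
  exists [seq pick Y | Y <- enum predT] => x Sx.
  have ix := gen_int x Sx.
  apply/mapP; exists (R x); first by rewrite mem_enum.
  rewrite /pick; case: pselect => [h|[]]; last by exists x.
  case: (cid h) => y /= [iy Ry]; have [ixy] := intB _ _ ix iy.
  rewrite Ry subrr => Rxy; apply: (regrep_inj coK lincombK).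
  have := redP ixy; rewrite -/R Rxy => /mxspecP s_xy.
  apply/eqP; rewrite -subr_eq0 -(regrepB coK lincombK); apply/eqP/matrixP => r s.
  rewrite [RHS]mxE; apply/eqP; apply: contrapT => /negP nz.
  apply: inj; exists (rho (x - y) r s) => //.
  by have := s_xy r s; rewrite [X in specializes _ X]mxE.
(* A lift of [1 - e] becomes a unit once a suitable power of [p], which reduces to [0], is added. *)
have [a [a' [ia Ra aa' a'a]]] : exists a a', [/\ int a, R a = 1 - e, a * a' = 1 & a' * a = 1].
  have [x0 ix0 Rx0] := Be; have [ia0 Ra0] := intB _ _ int1 ix0.
  have spX l : @specializes F P (p ^+ l.+1) 0.
    elim: l => [|l IHl] //; rewrite exprS -(mul0r 0); exact: specializesM.
  have [|l Ul] := @regular_shift _ _ (rho (1 - x0)) _ nz_p.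
    move=> l; apply: contraTneq (oner_neq0 (pres P)) => pl1.
    rewrite negbK; apply/eqP/(specializes_inj (specializes1 P)); rewrite -pl1; exact: spX.
  have [ip] := red_scalar iotaC coK lincombK (spX l).
  rewrite scale0r -/R => Rp.
  have [ia Ra] := intD _ _ ia0 ip.
  have [|a' [aa' a'a]] := regrep_unit iotaC coK lincombK (x := 1 - x0 + iota (p ^+ l.+1)).
    by rewrite (regrepD coK lincombK) (regrep_scalar iotaC coK lincombK).
  exists (1 - x0 + iota (p ^+ l.+1)), a'; split=> //.
  by rewrite Ra Ra0 Rp addr0 [R x0]Rx0 R1.
(* Since [1 + n] is invertible, its lift [u] is a unit. Take [d] to be the determinant of [rho u]:
   then [d] times [u'] is represented by the adjugate, hence integral. *)
have [u [u' [d [delta [[iu Ru uu' u'u] nz_delta idu' Rdu']]]]] : exists u u' d delta,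
    [/\ [/\ int u, R u = 1 + n, u * u' = 1 & u' * u = 1], delta != 0,
        int (iota d * u') & R (iota d * u') = delta *: (1 - n)].
  have [x0 ix0 Rx0] := Bn; have [iu Ru] := intD _ _ int1 ix0.
  rewrite [R x0]Rx0 R1 in Ru; set u := 1 + x0 in iu Ru.
  have n1: (1 + n) * (1 - n) = 1 by rewrite mulrBr mulr1 mulrDl mul1r nn addr0 addrK.
  have su := mxspec_det (redP iu); rewrite -/R Ru in su.
  have nz_d: \det (1 + n) != 0.
    apply: contraTneq (oner_neq0 (pres P)) => d0; rewrite negbK.
    by rewrite -(det1 _ m.+1) -[1%:M]n1 det_mulmx d0 mul0r.
  have nz_du: \det (rho u) != 0.
    apply: contraNneq nz_d => d0; rewrite d0 in su.
    by apply/eqP/(specializes_inj su)/specializes0.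
  have Uu: rho u \in unitmx by rewrite unitmxE unitfE.
  have [u' [uu' u'u]] := regrep_unit iotaC coK lincombK Uu.
  have [idu' _] : int (iota (\det (rho u)) * u') /\ R (iota (\det (rho u)) * u') = \adj (R u).
    apply: red_eq; rewrite (regrepZ iotaC coK lincombK).
    rewrite -mul_mx_scalar -mul_mx_adj mulmxA -(regrepM coK lincombK) u'u.
    by rewrite (regrep1 iotaC coK lincombK) mul1mx; apply/mxspec_adj/redP.
  exists u, u', (\det (rho u)), (\det (1 + n)); split=> //.
  have [_ Rd] := red_scalar iotaC coK lincombK su.
  have [_] := intM _ _ idu' iu; rewrite -mulrA u'u mulr1 Ru [R _]Rd.
  move/(congr1 (fun X => X * (1 - n))).
  by rewrite -mulrA n1 mulr1 -scalerAl mul1r => <-.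
have nz_rho: exists2 y, y \in entries _ _ (rho a') & y != 0.
  apply: contrapT => z; case/eqP: (oner_neq0 A); rewrite -aa'.
  rewrite (regrep_inj coK lincombK (_ : rho a' = rho 0)) ?mulr0 //.
  rewrite /rho -(subrr 1) (regrepB coK lincombK) subrr -/rho.
  apply/matrixP => r s; rewrite [RHS]mxE; apply/eqP; apply: contrapT => /negP nz.
  apply: z; exists (rho a' r s) => //.
  by apply/mapP; exists (r, s); rewrite ?mem_enum.
(* At an extended place [P'], the multiple of [a'] by [c] is integral and its representation has an
   entry [1], so its reduction is nonzero. *)
have [P' [h [ext [c [nz_c intc [_ /mapP[[r s] _ ->] Drs]]]]]] := place_normalize P nz_rho.
pose R' := red b co P'; pose int' := integral b co P'.
have intM' x y : int' x -> int' y -> int' (x * y) /\ R' (x * y) = R' x * R' y :=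
  fun ix iy => redM coK lincombK ix iy.
have lift x : int x -> int' x /\ R' x = map_mx h (R x).
  by move=> ix; apply: red_eq; apply: mxspec_ext ext (redP ix).
have [iz nz_z] : int' (iota c * a') /\ R' (iota c * a') != 0.
  have iz: int' (iota c * a').
    apply: mxspec_total => l q; rewrite (regrepZ iotaC coK lincombK) mxE.
    by apply: intc; apply/mapP; exists (l, q); rewrite ?mem_enum.
  split=> //; have /mxspecP/(_ r s) := redP iz.
  rewrite (regrepZ iotaC coK lincombK) mxE Drs => s1.
  apply: contraTneq (oner_neq0 (pres P')) => z0.
  rewrite /R' in z0; rewrite z0 mxE in s1.
  by rewrite negbK; apply/eqP/(specializes_inj (specializes1 P') s1).
have [ia' Ra'] := lift _ ia; rewrite Ra map_mxB map_mx1 in Ra'.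
set z := iota c * a' in iz nz_z; set E := map_mx h e in Ra'.
have hM (X Y : 'M[pres P]_m.+1) : map_mx h (X * Y) = map_mx h X * map_mx h Y.
  exact: map_mxM.
have h1 : map_mx h (1 : 'M[pres P]_m.+1) = 1 by exact: map_mx1.
have EE: E * E = E by rewrite -hM ee.
have nz_E: E != 0 by rewrite map_mx_eq0.
have scalar_out k : int' (iota k) -> exists s0, R' (iota k) = s0 *: 1.
  move=> ik; have := redP ik; rewrite (regrep_scalar iotaC coK lincombK) => /mxspecP/(_ 0 0).
  rewrite mxE eqxx => sk; exists (red b co P' (iota k) 0 0).
  by have [] := red_scalar iotaC coK lincombK sk.
have [az Daz] := intM' _ _ ia' iz; have [za Dza] := intM' _ _ iz ia'.
have Eaz: a * z = iota c by rewrite /z mulrA -iotaC -mulrA aa' mulr1.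
have Eza: z * a = iota c by rewrite /z -mulrA a'a mulr1.
rewrite Eaz in az Daz; rewrite Eza in za Dza.
have [s0' Ds0] := scalar_out _ az.
(* The scalar [c] is [a * z] with [a] reducing to [1 - E], so its reduction is killed by [E] and
   vanishes. Hence [z] is fixed by [E] on both sides after reduction. *)
have Dz0: R' (iota c) = 0.
  have: E * R' (iota c) = 0 by rewrite Daz Ra' mulrA mulrBr mulr1 EE subrr mul0r.
  rewrite Ds0 -scalerAr mulr1 => /eqP; rewrite scaler_eq0 (negPf nz_E) orbF => /eqP->.
  exact: scale0r.
rewrite Dz0 Ra' in Daz Dza.
have Ez: E * R' z = R' z.
  by move/eqP: Daz; rewrite mulrBl mul1r eq_sym subr_eq0 => /eqP.
have zE: R' z * E = R' z.
  by move/eqP: Dza; rewrite mulrBr mulr1 eq_sym subr_eq0 => /eqP.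
(* The residue field may have grown, but the reduction of [z] is a combination of reduced basis
   vectors, each of which [E] cuts down to a multiple of itself by [sc_e]. *)
have [al Dal] : exists al, R' z = al *: E.
  have [v1' spec1'] : exists v, @mxspec F P' _ _ (co 1) v.
    by exists (map_mx h v1); apply: mxspec_ext ext spec1.
  have [v _ Dv] := red_coord iotaC coK lincombK (fun l => (lift _ (int_b l)).1) spec1' iz.
  have /choice[al Dal] l := sc_e _ (ex_intro2 _ _ (b l) (int_b l) erefl).
  exists (\sum_l v 0 l * h (al l)).
  rewrite -zE -Ez [R' z]Dv mulr_sumr mulr_suml scaler_suml; apply: eq_bigr => l _.
  rewrite -scalerAr -scalerAl -scalerA; congr (_ *: _).
  by rewrite [red b co P' (b l)](lift _ (int_b l)).2 -!hM Dal map_mxZ.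
have nz_al: al != 0 by apply: contraNneq nz_z => al0; rewrite Dal al0 scale0r.
pose N := map_mx h n; pose G := map_mx h (R g); pose G' := map_mx h (R g').
have nz_N: N != 0 by rewrite map_mx_eq0.
have EN: E * N = N by rewrite -hM en.
have NE: N * E = 0 by rewrite -hM ne map_mx0.
have NN: N * N = 0 by rewrite -hM nn map_mx0.
have GG1: G * G' = 1 by rewrite -hM GG' h1.
have G1G: G' * G = 1 by rewrite -hM G'G h1.
have NGN: N * G * N = h t *: N by rewrite -!hM ngn map_mxZ.
have NG'N: N * G' * N = h t' *: N by rewrite -!hM ng'n map_mxZ.
have nz_ht: h t != 0 by rewrite fmorph_eq0.
have nz_ht': h t' != 0 by rewrite fmorph_eq0.
have [iu' Ru'] := lift _ iu; rewrite Ru map_mxD h1 -/N in Ru'.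
have [iv' Rv'] := lift _ idu'; rewrite Rdu' map_mxZ map_mxB h1 -/N in Rv'.
have [igl RG] := lift _ ig; rewrite -/G in RG.
have [igl' RG'] := lift _ ig'; rewrite -/G' in RG'.
clearbody N G G' E.
(* A projective form of reduction; it respects products as long as the product of the reductions
   does not vanish. *)
pose data Y x := exists k al, [/\ al != 0, int' (iota k * x) & R' (iota k * x) = al *: Y].
have dataM Y1 Y2 Y s1 x y : s1 != 0 -> Y1 * Y2 = s1 *: Y ->
    data Y1 x -> data Y2 y -> data Y (x * y).
  move=> nz_s1 DY [k1 [al1 [nz1 i1 D1]]] [k2 [al2 [nz2 i2 D2]]].
  exists (k1 * k2), (al1 * (al2 * s1)); rewrite !mulf_neq0 //.
  have ->: iota (k1 * k2) * (x * y) = iota k1 * x * (iota k2 * y).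
    by rewrite rmorphM -!mulrA; congr (_ * _); rewrite !mulrA iotaC.
  have [i12 ->] := intM' _ _ i1 i2; split=> //.
  by rewrite D1 D2 -scalerAl -scalerAr DY !scalerA !mulrA.
have data_int x Y : int' x -> R' x = Y -> data Y x.
  by move=> ix <-; exists 1, 1; rewrite rmorph1 mul1r scale1r oner_neq0.
have data_eq x Y Y' : data Y x -> Y = Y' -> data Y' x by move=> + <-.
have mulData Y1 Y2 x y : data Y1 x -> data Y2 y -> data (Y1 * Y2) (x * y).
  by apply: (dataM _ _ _ 1); rewrite ?oner_neq0 ?scale1r.
have dg: data G g by apply: data_int.
have dg': data G' g' by apply: data_int.
have da: data (1 - E) a by apply: data_int.
have da': data E a' by exists c, al.
have N1E: N * (1 - E) = N by rewrite mulrBr mulr1 NE subr0.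
have E1E: E * (1 - E) = 0 by rewrite mulrBr mulr1 EE subrr.
(* The reductions multiply to [E (1 + N) (1 - E) = N] here, and to [E (1 - N) (1 - E) = - N] for the
   inverse. *)
have dy: data N (a' * u * a).
  apply: data_eq (mulData _ _ _ _ (mulData _ _ _ _ da' (data_int _ _ iu' Ru')) da) _.
  by rewrite (mulrDr E) mulr1 EN mulrDl E1E N1E add0r.
have dy': data N (a' * u' * a).
  apply: (dataM (E * (1 - N)) (1 - E) N (-1)); rewrite ?oppr_eq0 ?oner_neq0 //.
    by rewrite (mulrBr E) mulr1 EN mulrBl E1E N1E sub0r scaleN1r.
  by apply: mulData da' _; exists d, (h delta); rewrite fmorph_eq0.
exists (fun x x' => data (N * G') x /\ data (G * N) x'); split.
- exists (a' * u * a * g'), (g * (a' * u' * a)); split.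
  + rewrite -!mulrA (mulrA g') g'g mul1r (mulrA a) aa' mul1r (mulrA u) uu' mul1r.
    by rewrite a'a.
  + rewrite -!mulrA (mulrA a) aa' mul1r (mulrA u') u'u mul1r (mulrA a') a'a mul1r.
    by rewrite gg'.
  by split; apply: mulData.
(* After cancelling [G' G], the commutator gives [N G N G'], a nonzero multiple of [N G'], and its
   inverse gives [G N G' N], a nonzero multiple of [G N]. *)
- move=> x x' xx' x'x [dx dx']; split.
    apply: (dataM N G' _ 1); rewrite ?oner_neq0 ?scale1r //.
    apply: (dataM (N * G' * G) (G * N) _ (h t)) => //; last exact: mulData.
    by rewrite -!mulrA (mulrA G') G1G mul1r mulrA NGN.
  apply: (dataM (G * (N * G') * G') (G * N) _ (h t')) => //.
    transitivity (G * (N * G' * (G' * G) * N)); first by rewrite !mulrA.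
    by rewrite G1G mulr1 NG'N scalerAr.
  by apply: (mulData) => //; apply: mulData.
- move=> x x' l [dx dx']; elim: l => [|l [IHx IHx']]; first by [].
  rewrite exprS [x' ^+ _]exprS; split.
    apply: (dataM _ _ _ (h t') _ _ nz_ht' _ dx IHx).
    by rewrite mulrA NG'N -scalerAl.
  apply: (dataM _ _ _ (h t) _ _ nz_ht _ dx' IHx').
  by rewrite -!mulrA (mulrA N) NGN -scalerAr.
(* With [x'] integral, so is [iota k], the product of [iota k * x] and [x']. It reduces to a scalar
   that is also a multiple of [N G' R' x'], hence is killed by [N] and vanishes; multiplying by the
   reduction of [x g] gives [al1 *: N = 0]. *)
move=> x x' x'x xx' [[k [al1 [nz1 ix Dx]]] _] /gen_int/lift[jx Jx] /gen_int/lift[jx' Jx'].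
have [ik] := intM' _ _ ix jx'; rewrite -mulrA xx' mulr1 Dx in ik * => Dk.
have [s1 Ds1] := scalar_out _ ik.
have s10: s1 = 0.
  have: N * R' (iota k) = 0.
    by rewrite Dk -scalerAl -scalerAr !mulrA NN !mul0r scaler0.
  by rewrite Ds1 -scalerAr mulr1 => /eqP; rewrite scaler_eq0 (negPf nz_N) orbF => /eqP.
have: R' (iota k) * (R' x * G) = al1 *: N.
  rewrite Dk -!scalerAl -!mulrA (mulrA (R' x')).
  have [_ <-] := intM' _ _ jx' jx; rewrite x'x.
  have [_] := red1 iotaC coK lincombK P'; rewrite -/R' => ->.
  by rewrite mul1r G1G mulr1.
rewrite Ds1 s10 scale0r mul0r => /esym/eqP.
by rewrite scaler_eq0 (negPf nz1) (negPf nz_N).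
Qed.
End Core.

(** * Matrices over a division subring *)

(** Passes from predicates, in which the hypotheses on [D] are phrased, to the ring types of the
    preceding results. *)
Lemma subring_type (R : nzRingType) (K : R -> Prop) :
    K 1 -> (forall x y, K x -> K y -> K (x - y)) ->
    (forall x y, K x -> K y -> K (x * y)) ->
  exists (S : nzRingType) (v : {rmorphism S -> R}),
    injective v /\ forall x, K x <-> exists y, v y = x.
Proof.
move=> K1 KB KM.
have K0: K 0 by rewrite -(subrr 1); apply: KB.
have KN x: K x -> K (- x) by move=> Kx; rewrite -sub0r; apply: KB.
have KD x y: K x -> K y -> K (x + y).
  by move=> Kx Ky; rewrite -[y]opprK; apply: KB => //; apply: KN.
pose W := {x | `[<K x>]}.
pose mk (x : R) (Kx : K x) : W := exist (fun x => `[<K x>]) x (asboolT Kx).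
have KW (x : W) : K (val x) by case: x => x /= /asboolP.
pose W0 : W := mk _ K0.
pose Wopp (x : W) : W := mk _ (KN _ (KW x)).
pose Wadd (x y : W) : W := mk _ (KD _ _ (KW x) (KW y)).
pose W1 : W := mk _ K1.
pose Wmul (x y : W) : W := mk _ (KM _ _ (KW x) (KW y)).
have addA: associative Wadd by move=> x y z; apply/val_inj/addrA.
have addC: commutative Wadd by move=> x y; apply/val_inj/addrC.
have add0: left_id W0 Wadd by move=> x; apply/val_inj/add0r.
have addN: left_inverse W0 Wopp Wadd by move=> x; apply/val_inj/addNr.
have mulA: associative Wmul by move=> x y z; apply/val_inj/mulrA.
have mul1: left_id W1 Wmul by move=> x; apply/val_inj/mul1r.
have mulr1: right_id W1 Wmul by move=> x; apply/val_inj/mulr1.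
have mulDl: left_distributive Wmul Wadd by move=> x y z; apply/val_inj/mulrDl.
have mulDr: right_distributive Wmul Wadd by move=> x y z; apply/val_inj/mulrDr.
have W10: W1 != W0 by apply/eqP => /(congr1 val)/eqP; rewrite oner_eq0.
pose zM := GRing.isZmodule.Build W addA addC add0 addN.
pose zT : zmodType := HB.pack W zM.
pose rM := GRing.Zmodule_isNzRing.Build zT mulA mul1 mulr1 mulDl mulDr W10.
pose rT : nzRingType := HB.pack W zM rM.
pose f (x : rT) : R := val (x : W).
have fB: zmod_morphism f by [].
have fM: monoid_morphism f by [].
pose f1 := GRing.isZmodMorphism.Build rT R f fB.
pose f2 := GRing.isMonoidMorphism.Build rT R f fM.
pose v : {rmorphism rT -> R} := HB.pack f f1 f2.
exists rT, v; split; first exact: val_inj.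
move=> x; split=> [Kx|[y <-]]; first by exists (mk x Kx).
exact: KW.
Qed.

Lemma subfield_type (R : nzRingType) (K : R -> Prop) :
    K 1 -> (forall x y, K x -> K y -> K (x - y)) ->
    (forall x y, K x -> K y -> K (x * y)) ->
    (forall x y, K x -> K y -> x * y = y * x) ->
    (forall x, K x -> x != 0 -> exists2 y, K y & y * x = 1) ->
  exists (S : fieldType) (v : {rmorphism S -> R}), forall x, K x <-> exists y, v y = x.
Proof.
move=> K1 KB KM KC KV; have [S [v [v_inj vP]]] := subring_type K1 KB KM.
have Kv x : K (v x) by apply/vP; exists x.
have mulC: commutative (@GRing.mul S).
  by move=> x y; apply: v_inj; rewrite !rmorphM; apply: KC.
pose cM := GRing.PzRing_hasCommutativeMul.Build S mulC.
pose cT : comNzRingType := HB.pack S cM.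
have inv (x : S) : {y : S | if x == 0 then y = 0 else y * x = 1}.
  apply: cid; have [_|nz_x] := eqVneq x 0; first by exists 0.
  have [|y /vP[z <-] zx] := KV _ (Kv x).
    by apply: contra nz_x => /eqP x0; apply/eqP/v_inj; rewrite x0 rmorph0.
  by exists z; apply: v_inj; rewrite rmorphM rmorph1.
pose Sinv (x : cT) : cT := sval (inv x).
have mulVf x : x != 0 -> Sinv x * x = 1.
  by move=> nz_x; rewrite /Sinv; case: (inv x) => y /=; rewrite (negPf nz_x).
have inv0 : Sinv 0 = 0.
  by rewrite /Sinv; case: (inv 0) => y /=; rewrite eqxx.
pose fM := GRing.ComNzRing_isField.Build cT mulVf inv0.
pose fT : fieldType := HB.pack S cM fM.
by exists fT, (v : {rmorphism fT -> R}).
Qed.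

Lemma gen_division_subringP (D : unitRingType) (s : seq D) :
  division_subring (gen_division_subring s).
Proof.
split.
- by move=> K [K1 _ _ _] _.
- move=> x y Kx Ky K HK sK; have [_ KB _ _] := HK.
  by apply: KB; [apply: Kx | apply: Ky].
- move=> x y Kx Ky K HK sK; have [_ _ KM _] := HK.
  by apply: KM; [apply: Kx | apply: Ky].
move=> x Kx nz_x K HK sK; have [_ _ _ KV] := HK.
by apply: KV => //; apply: Kx.
Qed.

Section MatrixAlgebra.
Variables (D : unitRingType) (n : nat) (K : D -> Prop).
Hypotheses (HD : is_division_ring D) (HK : division_subring K).
Hypothesis K_findim : findim_over_center K.

Let K1 : K 1. Proof. by case: HK. Qed.
Let KB x y : K x -> K y -> K (x - y). Proof. by case: HK => _ + _ _; apply. Qed.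
Let KM x y : K x -> K y -> K (x * y). Proof. by case: HK => _ _ + _; apply. Qed.
Let KV x : K x -> x != 0 -> K x^-1. Proof. by case: HK => _ _ _; apply. Qed.
Let K0 : K 0. Proof. by rewrite -(subrr 1); apply: KB. Qed.
Let KD x y : K x -> K y -> K (x + y).
Proof. by move=> Kx Ky; rewrite -[y]opprK -[- y]sub0r; apply: KB => //; apply: KB. Qed.

Lemma mul_delta_entry (i j a c : 'I_n.+1) d (X : 'M[D]_n.+1) :
  ((d *: delta_mx i j) *m X) a c = (a == i)%:R * (d * X j c).
Proof.
rewrite mxE (bigD1 j) //= big1 ?addr0 => [|l ne_l]; rewrite !mxE.
  by rewrite eqxx andbT; case: (a == i); rewrite ?mulr1 ?mul1r ?mulr0 ?mul0r.
by rewrite (negPf ne_l) andbF mulr0 mul0r.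
Qed.

Lemma mul_entry_delta (i j a c : 'I_n.+1) (X : 'M[D]_n.+1) :
  (X *m delta_mx i j) a c = X a i * (c == j)%:R.
Proof.
rewrite mxE (bigD1 i) //= big1 ?addr0 => [|l ne_l]; rewrite !mxE.
  by rewrite eqxx.
by rewrite (negPf ne_l) mulr0.
Qed.

Lemma mul_entry_scalar (a c : 'I_n.+1) d (X : 'M[D]_n.+1) :
  (X *m d%:M) a c = X a c * d.
Proof.
rewrite mxE (bigD1 c) //= big1 ?addr0 => [|l ne_l]; rewrite !mxE ?eqxx //.
by rewrite (negPf ne_l) mulr0.
Qed.

Lemma mul_scalar_entry (a c : 'I_n.+1) d (X : 'M[D]_n.+1) :
  (d%:M *m X) a c = d * X a c.
Proof. by rewrite mul_scalar_mx mxE. Qed.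

(** Everything comes from matrix units: they move a nonzero entry of [z], made [1] by its inverse,
    to each diagonal place; commuting with them forces a scalar matrix; their multiples by a
    spanning family of [K] over its center span. *)
Lemma matrix_algebra : exists (F : fieldType) (A : nzRingType)
    (iota : {rmorphism F -> A}) (v : {rmorphism A -> 'M[D]_n.+1}),
  [/\ injective v, forall X : 'M[D]_n.+1, (forall i j, K (X i j)) <-> exists x, v x = X,
      forall c x, iota c * x = x * iota c &
   [/\ forall z : A, z != 0 -> exists l : seq (A * A), \sum_(p <- l) p.1 * z * p.2 = 1,
      forall z : A, (forall x, z * x = x * z) -> exists c, z = iota c &
      exists (I : finType) (s : I -> A),
        forall x, exists c : I -> F, x = \sum_i iota (c i) * s i]].
Proof.
pose MK (X : 'M[D]_n.+1) := forall i j, K (X i j).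
have [|||A [v [v_inj vP]]] := @subring_type _ MK.
- by move=> i j; rewrite mxE; case: (i == j).
- by move=> X Y KX KY i j; rewrite !mxE; apply: KB.
- move=> X Y KX KY i j; rewrite mxE; elim/big_ind: _ => // l _; exact: KM.
pose Z := subring_center K.
have [|||||F [w wP]] := @subfield_type _ Z.
- by split=> // y _; rewrite mulr1 mul1r.
- move=> x y [Kx xC] [Ky yC]; split; first exact: KB.
  by move=> z Kz; rewrite mulrBl mulrBr xC // yC.
- move=> x y [Kx xC] [Ky yC]; split; first exact: KM.
  by move=> z Kz; rewrite -mulrA yC // mulrA xC // mulrA.
- by move=> x y [_ xC] [Ky _]; apply: xC.
- move=> x [Kx xC] nz_x; have Ux := HD nz_x; exists x^-1; last by rewrite mulVr.
  split; first exact: KV.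
  by move=> y Ky; apply: (mulrI Ux); rewrite mulrA mulrV // mul1r mulrA xC // mulrK.
have Zw c : Z (w c) by apply/wP; exists c.
have /choice[iota0 iota0E] (c : F) : exists x, v x = (w c)%:M.
  apply/vP => i j; rewrite mxE; case: (i == j); last exact: K0.
  by case: (Zw c).
have iotaB : zmod_morphism iota0.
  by move=> c d; apply: v_inj; rewrite rmorphB /= !iota0E rmorphB /= raddfB.
have iotaM : monoid_morphism iota0.
  split=> [|c d]; apply: v_inj; first by rewrite iota0E !rmorph1.
  by rewrite rmorphM /= !iota0E rmorphM /= scalar_mxM.
pose f1 := GRing.isZmodMorphism.Build F A iota0 iotaB.
pose f2 := GRing.isMonoidMorphism.Build F A iota0 iotaM.
pose iota : {rmorphism F -> A} := HB.pack iota0 f1 f2.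
have iotaE c : v (iota c) = (w c)%:M := iota0E c.
have Kv x i j : K (v x i j) by move: i j; apply/vP; exists x.
have Kdelta i j d : K d -> exists x, v x = d *: delta_mx i j.
  move=> Kd; apply/vP => a c; rewrite !mxE.
  by case: (_ && _); rewrite ?mulr1 ?mulr0.
exists F, A, iota, v; split=> //.
  move=> c x; apply: v_inj; rewrite !rmorphM /= !iotaE; apply/matrixP => i j.
  rewrite [LHS]mul_scalar_entry [RHS]mul_entry_scalar.
  by case: (Zw c) => _; apply.
split.
- move=> z nz_z.
  have [i0 [j0 nz_d]] : exists i j, v z i j != 0.
    apply: contrapT => z0; case/eqP: nz_z; apply: v_inj; rewrite rmorph0.
    apply/matrixP => i j; rewrite [RHS]mxE; apply/eqP; apply: contrapT => /negP nz.
    by apply: z0; exists i, j.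
  set d := v z i0 j0 in nz_d.
  have /choice[x xE] i := Kdelta i i0 _ (KV (Kv z i0 j0) nz_d).
  have /choice[y yE] i := Kdelta j0 i _ K1.
  exists [seq (x i, y i) | i <- enum 'I_n.+1]; apply: v_inj.
  rewrite big_map rmorph_sum rmorph1 /=; apply/matrixP => a c; rewrite summxE.
  rewrite big_enum /= (bigD1 a) //= big1 => [|i ne_i]; rewrite !rmorphM /= xE yE scale1r.
    rewrite [_ a c]mul_entry_delta [X in X * _]mul_delta_entry eqxx mul1r addr0.
    by rewrite mulVr ?HD // mul1r mxE eq_sym.
  rewrite [_ a c]mul_entry_delta [X in X * _]mul_delta_entry eq_sym (negPf ne_i).
  by rewrite !mul0r.
- move=> z zC.
  have Dz a i j : v z a i = (a == i)%:R * v z j j.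
    have [x xE] := Kdelta i j _ K1; have /(congr1 v) := zC x.
    rewrite !rmorphM /= xE => /matrixP/(_ a j).
    rewrite [X in _ = X]mul_delta_entry scale1r [X in X = _]mul_entry_delta.
    by rewrite eqxx mulr1 mul1r.
  have [|c Dc] := (iffLR (wP (v z 0 0))); last first.
    exists c; apply: v_inj; rewrite iotaE Dc; apply/matrixP => a i.
    by rewrite (Dz a i 0) mxE; case: (a == i); rewrite ?mul1r ?mul0r.
  split=> [|y Ky]; first exact: Kv.
  have [x xE] : exists x, v x = y%:M.
    by apply/vP => i j; rewrite mxE; case: (i == j).
  have /(congr1 v) := zC x; rewrite !rmorphM /= xE => /matrixP/(_ 0 0).
  by rewrite [X in X = _]mul_entry_scalar [X in _ = X]mul_scalar_entry.
have [b [Kb spanb]] := K_findim.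
pose I : finType := ('I_(size b) * ('I_n.+1 * 'I_n.+1))%type.
have /choice[s sE] (l : I) := Kdelta l.2.1 l.2.2 _ (Kb _ (mem_nth 0 (ltn_ord l.1))).
exists I, s => x.
have /choice[c cE] (ij : 'I_n.+1 * 'I_n.+1) : exists c : 'I_(size b) -> F,
    v x ij.1 ij.2 = \sum_i w (c i) * b`_i.
  have [c [sz_c [Zc Dx]]] := spanb _ (Kv x ij.1 ij.2).
  have /choice[c' c'E] (i : 'I_(size b)) : exists u, w u = c`_i.
    by apply/wP/Zc/mem_nth; rewrite sz_c.
  by exists c'; rewrite Dx; apply: eq_bigr => i _; rewrite c'E.
exists (fun l : I => c l.2 l.1); apply: v_inj; rewrite rmorph_sum /=.
apply/matrixP => p q; rewrite summxE [LHS](cE (p, q)).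
transitivity (\sum_(i < size b) \sum_ij v (iota (c ij i) * s (i, ij)) p q); last first.
  by rewrite pair_bigA; apply: eq_bigr => -[].
apply: eq_bigr => i _; have vE ij :
    v (iota (c ij i) * s (i, ij)) p q = w (c ij i) * (b`_i *+ (ij == (p, q))).
  case: ij => p' q'; rewrite rmorphM /= iotaE sE [LHS]mul_scalar_entry !mxE /= xpair_eqE.
  by rewrite ![_ == p]eq_sym ![_ == q]eq_sym mulr_natr.
rewrite (bigD1 (p, q)) //= vE eqxx big1 ?addr0 // => ij ne_ij.
by rewrite vE (negPf ne_ij) mulr0.
Qed.
End MatrixAlgebra.

(** * Descent along the almost subnormal chain *)

Lemma finite_index_power (D : unitRingType) (n : nat) (H K : 'M[D]_n.+1 -> Prop)
    (x x' : 'M[D]_n.+1) :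
  is_subgroup H -> is_subgroup K -> finite_index_in H K ->
  K x -> x * x' = 1 -> x' * x = 1 -> exists N, H (x ^+ N.+1).
Proof.
move=> [HGL H1 HM HV] [KGL K1 KM _] [gs [Kgs cover]] Kx xx' x'x.
have KX i : K (x ^+ i) by elim: i => [|i IHi]; rewrite ?expr0 // exprS; apply: KM.
have xXV i : x' ^+ i * x ^+ i = 1.
  elim: i => [|i IHi]; first by rewrite mulr1.
  by rewrite exprSr exprS mulrA -(mulrA _ x') x'x mulr1.
(* There is one more power of [x] than coset representatives, so two powers lie in the same left
   coset of [H]. *)
have /choice[t tP] (i : 'I_(size gs).+1) : exists j : 'I_(size gs), exists2 h,
    H h & x ^+ i = gs`_j * h.
  have [g gsg [h Hh Dx]] := cover _ (KX i).
  have lt_g: (index g gs < size gs)%N by rewrite index_mem.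
  by exists (Ordinal lt_g), h; rewrite //= nth_index.
have /injectivePn[i [j neq_ij Dij]] : ~~ injectiveb t.
  by apply/negP => /injectiveP/leq_card; rewrite !card_ord ltnn.
wlog lt_ij: i j neq_ij Dij / (i < j)%N => [IH|].
  have [lt_ij|lt_ji|/val_inj eq_ij] := ltngtP i j; first exact: (IH i j).
    by apply: (IH j i); rewrite // eq_sym.
  by rewrite eq_ij eqxx in neq_ij.
have [h Hh Dx] := tP i; have [h' Hh' Dx'] := tP j; rewrite -Dij in Dx'.
have [k [hk kh]] := HGL _ Hh.
have [g' [_ g'g]] := KGL _ (Kgs _ (mem_nth 0 (ltn_ord (t i)))).
exists (j - i).-1; rewrite prednK ?subn_gt0 //.
have ->: x ^+ (j - i) = k * h'.
  have Dj: x ^+ j = x ^+ i * (k * h').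
    have hk1 : h * k = 1 := hk.
    by rewrite Dx Dx' -mulrA [h * _]mulrA hk1 mul1r.
  rewrite -[LHS]mul1r -(xXV i) -mulrA -exprD subnKC ?(ltnW lt_ij) // Dj.
  by rewrite mulrA xXV mul1r.
by apply: HM => //; apply: HV hk kh.
Qed.

Lemma subring_gen_base (A : nzRingType) (S : seq A) s : s \in S -> subring_gen S s.
Proof. by move=> Ss K _ _ _ KS; apply: KS. Qed.

Lemma subring_gen1 (A : nzRingType) (S : seq A) : subring_gen S 1.
Proof. by move=> K K1 _ _ _. Qed.

Lemma subring_genM (A : nzRingType) (S : seq A) x y :
  subring_gen S x -> subring_gen S y -> subring_gen S (x * y).
Proof.
by move=> Sx Sy K K1 KB KM KS; apply: (KM) => //; [apply: Sx | apply: Sy].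
Qed.

Theorem theorem5p4 (D : unitRingType) (n : nat) (G : 'M[D]_n -> Prop) :
  is_division_ring D -> weakly_locally_finite D -> (1 <= n)%N ->
  is_subgroup G -> infinite_pred G -> almost_subnormal G (@GLn D n) ->
  fin_generated G -> central_in_GL G.
Proof.
case: n G => // n G HD wlf _ sgG infG [r [Hs [Hs0 Hsr sgHs stepHs]]] [gs [Ggs genG]].
move=> g Gg A0 _; apply: contrapT => ncomm.
have [GGL G1 GM GV] := sgG.
have /choice[inv invP] (x : 'M[D]_n.+1) :
    exists y, G x -> [/\ G y, x * y = 1 & y * x = 1].
  have [Gx|nGx] := pselect (G x); last by exists 0.
  by have [y [xy yx]] := GGL _ Gx; exists y => _; split=> //; apply: GV xy yx.
(* Inverses are listed because elements of [G] must lie in the subring generated by [S], which is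
   not closed under inversion. *)
pose T := gs ++ [seq inv x | x <- gs] ++ [:: g; inv g].
pose s := flatten [seq [seq X ij.1 ij.2 | ij <- enum predT] | X : 'M[D]_n.+1 <- A0 :: T].
have HK := gen_division_subringP s.
have sK X i j : X \in A0 :: T -> gen_division_subring s (X i j).
  move=> TX K' _; apply; apply/flattenP.
  exists [seq X ij.1 ij.2 | ij <- enum predT]; first by apply/mapP; exists X.
  by apply/mapP; exists (i, j); rewrite ?mem_enum.
have [F [A [iota [v [v_inj vP iotaC [A_simple A_center [I [s0 s0_spans]]]]]]]] :=
  @matrix_algebra D n _ HD HK (wlf s).
have /choice[lift liftP] (X : 'M[D]_n.+1) : exists x, X \in A0 :: T -> v x = X.
  have [TX|nTX] := boolP (X \in A0 :: T); last by exists 0.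
  have /vP[x Dx] i j : gen_division_subring s (X i j) by apply: sK.
  by exists x.
have liftT X : X \in T -> v (lift X) = X by move=> TX; rewrite liftP // inE TX orbT.
pose S := [seq lift X | X <- T].
have Tgs x : x \in gs -> x \in T by rewrite mem_cat => ->.
have Tinv x : x \in gs -> inv x \in T by move=> gsx; rewrite !mem_cat map_f ?orbT.
have Tg: g \in T by rewrite !mem_cat mem_head !orbT.
have Tg': inv g \in T by rewrite !mem_cat !inE eqxx !orbT.
have [Gg' gg' g'g] := invP g Gg.
(* A subgroup that contains the generators, hence all of [G]. It records that the inverse is in the
   subring as well, as [Qout] requires. *)
pose H X := exists y y',
  [/\ v y = X, y * y' = 1, y' * y = 1, subring_gen S y & subring_gen S y'].
have GH x : G x -> H x.
  move=> Gx; apply: (genG x Gx); last first.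
    move=> X gsX; exists (lift X), (lift (inv X)).
    have [GX' XX' X'X] := invP X (Ggs X gsX).
    have [TX TX'] := (Tgs X gsX, Tinv X gsX).
    split; first exact: liftT.
    - by apply: v_inj; rewrite rmorphM rmorph1 /= !liftT //; apply: XX'.
    - by apply: v_inj; rewrite rmorphM rmorph1 /= !liftT //; apply: X'X.
    - by apply: subring_gen_base; apply: map_f.
    by apply: subring_gen_base; apply: map_f.
  split.
  - move=> X [y [y' [<- yy' y'y _ _]]]; exists (v y').
    by split; rewrite -[_ *m _]rmorphM ?yy' ?y'y rmorph1.
  - by exists 1, 1; rewrite rmorph1 mulr1; split=> //; apply: subring_gen1.
  - move=> _ _ [y [y' [<- yy' y'y Sy Sy']]] [z [z' [<- zz' z'z Sz Sz']]].
    exists (y * z), (z' * y'); rewrite rmorphM; split=> //; try exact: subring_genM.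
      by rewrite mulrA -(mulrA y) zz' mulr1.
    by rewrite mulrA -(mulrA z') y'y mulr1.
  move=> _ X' [y [y' [<- yy' y'y Sy Sy']]] yX' X'y; exists y', y; split=> //.
  rewrite -[LHS]mulr1 -[1]yX' [_ * _]mulrA.
  by rewrite -[v y' * v y]rmorphM y'y rmorph1 mul1r.
have gl: lift g * lift (inv g) = 1.
  by apply: v_inj; rewrite rmorphM rmorph1 /= !liftT.
have lg: lift (inv g) * lift g = 1.
  by apply: v_inj; rewrite rmorphM rmorph1 /= !liftT.
have nc: exists x, lift g * x <> x * lift g.
  exists (lift A0) => /(congr1 v); rewrite !rmorphM /= liftT // liftP ?mem_head //.
have S_inf: ~ exists T' : seq A, forall x, subring_gen S x -> x \in T'.
  case=> T' T'P; apply: infG; exists [seq v x | x <- T'] => x /GH[y [y' [<- _ _ Sy _]]].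
  exact/map_f/T'P.
have [Q [[x0 [x0' [xx0 x'x0 Q0]]] Qcomm Qpow Qout]] :=
  escaping_units iotaC A_simple A_center s0_spans (map_f lift Tg) (map_f lift Tg')
    gl lg nc S_inf.
have sub i : (i <= r)%N -> forall x, G x -> Hs i x.
  move=> le_ir x Gx; have: Hs r x by apply/Hsr.
  have [d] := ubnP (r - i)%N; elim: d i le_ir => // d IHd i le_ir.
  rewrite ltnS => le_d Hx; move: (le_ir); rewrite leq_eqVlt => /predU1P[->//|lt_ir].
  have [sHs _] := stepHs i lt_ir; apply: sHs; apply: IHd => //.
  by rewrite subnS; apply: leq_trans le_d; rewrite prednK ?subn_gt0.
have chain i : (i <= r)%N -> exists x x',
    [/\ Hs i (v x), x * x' = 1, x' * x = 1 & Q x x'].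
  elim: i => [|i IHi] le_ir.
    exists x0, x0'; split=> //; apply/Hs0; exists (v x0').
    by split; rewrite -[_ *m _]rmorphM ?xx0 ?x'x0 rmorph1.
  have [x [x' [Hx xx' x'x Qx]]] := IHi (ltnW le_ir).
  have [sHs [nHs|fHs]] := stepHs i le_ir; last first.
    have vxx': v x * v x' = 1 by rewrite -rmorphM xx' rmorph1.
    have vx'x: v x' * v x = 1 by rewrite -rmorphM x'x rmorph1.
    have [N HN] := finite_index_power (sgHs _ le_ir) (sgHs _ (ltnW le_ir)) fHs Hx vxx' vx'x.
    have comm : GRing.comm x x' by rewrite /GRing.comm xx' x'x.
    exists (x ^+ N.+1), (x' ^+ N.+1); split; last exact: Qpow.
    - by rewrite rmorphXn.
    - by rewrite -exprMn_comm // xx' expr1n.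
    by rewrite -exprMn_comm ?x'x ?expr1n //; apply/commr_sym.
  (* Since [g] belongs to every term of the chain, normality puts its conjugate by [x], and then the
     commutator, in the next term. *)
  exists (x * lift g * x' * lift (inv g)), (lift g * x * lift (inv g) * x'); split.
  - have [_ _ HM _] := sgHs _ le_ir; rewrite !rmorphM /= !liftT //.
    apply: HM; last exact: sub.
    apply: (nHs _ g) => //; first exact: sub.
      by rewrite -[_ *m _]rmorphM xx' rmorph1.
    by rewrite -[_ *m _]rmorphM x'x rmorph1.
  - rewrite -!mulrA (mulrA (lift (inv g)) (lift g)) lg mul1r (mulrA x' x) x'x mul1r.
    by rewrite (mulrA (lift g)) gl mul1r xx'.
  - rewrite -!mulrA (mulrA x' x) x'x mul1r (mulrA _ (lift g)) lg mul1r.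
    by rewrite (mulrA x x') xx' mul1r gl.
  exact: Qcomm.
have [x [x' [/Hsr/GH[y [y' [/v_inj -> yy' y'y Sy Sy']]] xx' x'x Qx]]] := chain r (leqnn r).
apply: (Qout x x') => //.
have ->: x' = y'; last by [].
by rewrite -[x']mulr1 -yy' mulrA x'x mul1r.
Qed.
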